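(* Suppose that for each $\theta\in B_R(\theta^\dagger)$ the equation $F_\theta(u)=\varphi$ is solvable at some $u^*\in B_{r/2}(u^\dagger)$ (with $u^*$ depending on $\theta$). (i) Assume that there is a constant $M_r>0$ with $$\|F_\theta'(u)\|_{\mathcal V\to\mathcal U^*\times H}\le M_r<\sqrt2\qquad\forall u\in B_r(u^\dagger),$$ and a constant $\mu_r>0$ such that the weak tangential cone condition $$2\big(F_\theta(u)-F_\theta(v),\,F_\theta'(u)(u-v)\big)_{\mathcal U^*\times H}\ge (M_r^2+\mu_r)\,\|F_\theta(u)-F_\theta(v)\|^2_{\mathcal U^*\times H}\qquad\forall u,v\in B_r(u^\dagger)$$ holds, both uniformly for all $\theta\in B_R(\theta^\dagger)$. Then for each $\theta\in B_R(\theta^\dagger)$ the whole sequence $\{u_k\}$ defined by $$u_0\in B_{r/2}(u^* ),\qquad u_{k+1}=u_k-F_\theta'(u_k)^*\big(F_\theta(u_k)-\varphi\big),\quad k\in\mathbb N_0,$$ remains in the ball $B_r(u^\dagger)$ for all $k$. Furthermore, the sequence $\{u_k\}$ converges weakly in $\mathcal V$ to a solution of $F_\theta(u)=\varphi$. (ii) If additionally $F_\theta$ is coercive, in the sense that there exist $C_{coe}>0$ and $\alpha\ge1$ such that $$C_{coe}\,\|F_\theta(u)-F_\theta(u^* )\|_{\mathcal U^*\times H}\ge\|u-u^*\|_{\mathcal V}^{\alpha}$$ for all $u\in B_r(u^\dagger)$ and all $\theta\in B_R(\theta^\dagger)$, then $\{u_k\}$ converges strongly in $\mathcal V$, with rate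 $$\|u_k-u^*\|_{\mathcal V}=\mathcal O\Big(\frac1{k^{1/(2\alpha)}}\Big),\qquad \|F_\theta(u_k)-\varphi\|_{\mathcal U^*\times H}=\mathcal O\Big(\frac1{k^{1/(2\alpha)}}\Big)\qquad(k\to\infty).$$
   Context: Let $T>0$, let $X$ be a Hilbert space, and let $U\hookrightarrow H\hookrightarrow U^*$ be a Gelfand triple of Hilbert spaces. Put $\mathcal U=L^2(0,T;U)$, $\mathcal U^*=L^2(0,T;U^* )$, and $\mathcal V=\{u\in\mathcal U:\dot u\in\mathcal U^*\}$ (a Hilbert space, continuously embedded in $C([0,T];H)$). Let $A:X\to H$ be linear and bounded, and let $f:(0,T)\times X\times U\to U^*$ be a (nonlinear) Carathéodory map inducing a Nemytskii operator $f:X\times\mathcal V\to\mathcal U^*$, $[f(\theta,u)](t)=f(t,\theta,u(t))$. For $\theta\in X$ define $$F_\theta:\mathcal V\to\mathcal U^*\times H,\qquad F_\theta(u)=\big(\dot u+f(\theta,u),\;A\theta-u|_{t=0}\big),\qquad \varphi:=(0,0)\in\mathcal U^*\times H.$$ $F_\theta$ is (Fréchet) differentiable in $u$ with derivative $F_\theta'(u):\mathcal V\to\mathcal U^*\times H$, and $F_\theta'(u)^*:\mathcal U^*\times H\to\mathcal V$ is its Hilbert space adjoint. $\theta^\dagger\in X$ is the exact parameter and $u^\dagger\in\mathcal V$ the corresponding exact state, $F_{\theta^\dagger}(u^\dagger)=\varphi$. $B_R(\theta^\dagger)\subset X$ is the ball of radius $R>0$ about $\theta^\dagger$; $B_\rho(w)\subseteq\mathcal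 V$ is the closed ball of radius $\rho$ about $w$; $r>0$ is fixed. *)

(* Defs.v *)
From HB Require Import structures.
From mathcomp Require Import all_boot all_order all_algebra.
From mathcomp Require Import all_classical all_reals all_analysis.
From mathcomp Require Import measurable_realfun ring lra.

Set Implicit Arguments.
Unset Strict Implicit.
Unset Printing Implicit Defensive.

Import Order.TTheory GRing.Theory Num.Theory.
Import numFieldNormedType.Exports.

Local Open Scope classical_set_scope.
Local Open Scope ring_scope.

HB.mixin Record NormedModule_isPreHilbert (R : realType) V
    & NormedModule R V := {
  dot : V -> V -> R;
  dotC : forall x y, dot x y = dot y x;
  dotDl : forall x y z, dot (x + y) z = dot x z + dot y z;
  dotZl : forall a x y, dot (a *: x) y = a * dot x y;
  dot_norm : forall x, dot x x = `|x| ^+ 2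
}.

#[short(type="preHilbertType")]
HB.structure Definition PreHilbert (R : realType) :=
  {V of NormedModule R V & NormedModule_isPreHilbert R V}.

#[short(type="hilbertType")]
HB.structure Definition Hilbert (R : realType) :=
  {V of PreHilbert R V & Complete V}.

(* Locked, like [L2dot] below, so that unification does not compare the norms of
   different spaces by unfolding them down to integrals. *)
HB.lock Definition form_norm (R : realType) (V : Type) (form : V -> V -> R)
    (x : V) : R := Num.sqrt (form x x).
Canonical form_norm_unlockable := Unlockable form_norm.unlock.

HB.factory Record Lmodule_isPreHilbert (R : realType) V
    & GRing.Lmodule R V := {
  form : V -> V -> R;
  formC : forall x y, form x y = form y x;
  formDl : forall x y z, form (x + y) z = form x z + form y z;
  formZl : forall a x y, form (a *: x) y = a * form x y;
  form_ge0 : forall x, 0 <= form x x;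
  form_eq0 : forall x, form x x = 0 -> x = 0
}.

HB.builders Context R V & Lmodule_isPreHilbert R V.

Let norm (x : V) : R := form_norm form x.

Let normE x : norm x = Num.sqrt (form x x).
Proof. by rewrite /norm unlock. Qed.

Let normsq x : norm x ^+ 2 = form x x.
Proof. by rewrite normE sqr_sqrtr ?form_ge0. Qed.

Let formDr x y z : form x (y + z) = form x y + form x z.
Proof. by rewrite formC formDl !(formC _ x). Qed.

Let formZr a x y : form x (a *: y) = a * form x y.
Proof. by rewrite formC formZl formC. Qed.

Let CS x y : form x y ^+ 2 <= form x x * form y y.
Proof.
have [/form_eq0 ->|q0] := eqVneq (form y y) 0.
  by rewrite -(scale0r 0) formZr formZl !mul0r expr0n mulr0.
have qp : 0 < form y y by rewrite lt0r q0 form_ge0.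
have := form_ge0 (form y y *: x + (- form x y) *: y).
rewrite !(formDl, formDr, formZl, formZr) (formC y x).
have -> : form y y * (form y y * form x x) + form y y * (- form x y * form x y)
  + (- form x y * (form y y * form x y)
     + - form x y * (- form x y * form y y)) =
  form y y * (form x x * form y y - form x y ^+ 2) by ring.
by rewrite pmulr_rge0// subr_ge0.
Qed.

Let ler_normD x y : norm (x + y) <= norm x + norm y.
Proof.
have n0 z : 0 <= norm z by rewrite normE sqrtr_ge0.
rewrite -(@ler_pXn2r _ 2)// ?nnegrE ?addr_ge0//.
rewrite sqrrD !normsq !(formDl, formDr) (formC y x).
suff : form x y <= norm x * norm y by move=> ?; lra.
rewrite (le_trans (ler_norm _))// -(@ler_pXn2r _ 2)// ?nnegrE ?mulr_ge0//.
by rewrite exprMn !normsq real_normK ?num_real// CS.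
Qed.

Let normrZ a x : norm (a *: x) = `|a| * norm x.
Proof.
by rewrite !normE formZl formZr mulrA -expr2 sqrtrM ?sqr_ge0// sqrtr_sqr.
Qed.

Let normr0_eq0 x : norm x = 0 -> x = 0.
Proof. by move=> x0; apply: form_eq0; rewrite -normsq x0 expr0n. Qed.

HB.instance Definition _ :=
  Lmodule_isNormed.Build R V ler_normD normrZ normr0_eq0.

Let form_normE (x : V) : form x x = `|x| ^+ 2.
Proof. by rewrite -normsq. Qed.

HB.instance Definition _ :=
  NormedModule_isPreHilbert.Build R V formC formDl formZl form_normE.

HB.end.

Section dot_theory.
Context {R : realType} {V : preHilbertType R}.
Implicit Types x y z : V.

Lemma dotDr x y z : dot x (y + z) = dot x y + dot x z.
Proof. by rewrite dotC dotDl !(dotC x). Qed.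

Lemma dotZr a x y : dot x (a *: y) = a * dot x y.
Proof. by rewrite dotC dotZl dotC. Qed.

Lemma dot0l y : dot 0 y = 0.
Proof. by rewrite -(scale0r 0) dotZl mul0r. Qed.

Lemma dotNl x y : dot (- x) y = - dot x y.
Proof. by rewrite -scaleN1r dotZl mulN1r. Qed.

Lemma dot_ge0 x : 0 <= dot x x.
Proof. by rewrite dot_norm sqr_ge0. Qed.

Lemma dot_eq0 x : dot x x = 0 -> x = 0.
Proof. by rewrite dot_norm => /eqP; rewrite sqrf_eq0 normr_eq0 => /eqP. Qed.

Lemma dot_le_avg x y : `|dot x y| <= (dot x x + dot y y) / 2.
Proof.
have h a : a ^+ 2 = 1 -> a * dot x y <= (dot x x + dot y y) / 2.
  move=> a2; have := dot_ge0 (x - a *: y).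
  rewrite -scaleNr !(dotDl, dotDr, dotZl, dotZr) (dotC y x).
  have -> : - a * (- a * dot y y) = dot y y by rewrite mulrA mulrNN -expr2 a2 mul1r.
  lra.
have h1 := h 1 (expr1n _ _).
have h2 := h (-1) (etrans (sqrrN _) (expr1n _ _)).
by rewrite ler_norml; apply/andP; split; lra.
Qed.

End dot_theory.

(* The Cartesian product with the Hilbert (l^2) norm; the library's norm on
   [A * B] is the max norm. *)
Definition hprod (R : realType) (A B : preHilbertType R) : Type := (A * B)%type.

Section hprod.
Context {R : realType} {A B : preHilbertType R}.

HB.instance Definition _ := GRing.Lmodule.copy (hprod A B) (A * B)%type.

Let form (x y : hprod A B) : R := dot x.1 y.1 + dot x.2 y.2.

Let formC x y : form x y = form y x.
Proof. by rewrite /form (dotC x.1) (dotC x.2). Qed.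

Let formDl x y z : form (x + y) z = form x z + form y z.
Proof. by rewrite /form !dotDl addrACA. Qed.

Let formZl a x y : form (a *: x) y = a * form x y.
Proof. by rewrite /form !dotZl mulrDr. Qed.

Let form_ge0 x : 0 <= form x x.
Proof. by rewrite addr_ge0 ?dot_ge0. Qed.

Let form_eq0 x : form x x = 0 -> x = 0.
Proof.
move=> /eqP; rewrite paddr_eq0 ?dot_ge0// => /andP[/eqP + /eqP].
by case: x => a b /= /dot_eq0 -> /dot_eq0 ->.
Qed.

HB.instance Definition _ := Lmodule_isPreHilbert.Build R (hprod A B)
  formC formDl formZl form_ge0 form_eq0.

End hprod.

Section operators.
Context {R : realType}.

Definition opnorm (V W : normedModType R) (L : V -> W) : \bar R :=
  ereal_sup [set `|L v|%:E | v in [set v : V | `|v| <= 1]].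

(* For bounded linear [L] on complete [V] the set below is a singleton, by
   Riesz representation. *)
Definition adjoint (V W : preHilbertType R) (L : V -> W) (w : W) : V :=
  xget 0 [set v | forall z, dot (L z) w = dot z v].

Definition weakly_cvg (V : normedModType R) (u : nat -> V) (v : V) : Prop :=
  forall l : {linear V -> R^o}, continuous l -> l (u n) @[n --> \oo] --> l v.

End operators.

Section strongly_measurable.
Context {R : realType}.

Definition simple_fun (E : normedModType R) (s : R -> E) : Prop :=
  finite_set (range s) /\
  forall y, measurable (s @^-1` [set y] : set (measurableTypeR R)).

(* On a Borel set [D]: every function that is only an a.e. limit of simple
   functions agrees a.e. on [D] with one that is strongly measurable in this
   sense. *)
Definition strongly_measurable (E : normedModType R) (D : set R) (f : R -> E) :
    Prop :=
  exists2 s : nat -> R -> E, (forall n, simple_fun (s n)) &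
    forall t, D t -> s n t @[n --> \oo] --> f t.

Lemma simple_fun_comp2 (E F G : normedModType R) (h : E -> F -> G)
    (s : R -> E) (s' : R -> F) :
  simple_fun s -> simple_fun s' -> simple_fun (fun t => h (s t) (s' t)).
Proof.
move=> [fs ms] [fs' ms']; split.
  apply: (@sub_finite_set _ _ ((fun p => h p.1 p.2) @` (range s `*` range s'))).
    by move=> _ [t _ <-]; exists (s t, s' t) => //; split => /=; exists t.
  by apply/finite_image/finite_setX.
move=> y.
rewrite (_ : _ @^-1` _ = \bigcup_(p in (range s `*` range s') `&`
    [set p | h p.1 p.2 = y]) (s @^-1` [set p.1] `&` s' @^-1` [set p.2])).
  apply: fin_bigcup_measurable => [|p _]; last exact: measurableI.
  by apply: finite_setIl; exact: finite_setX.
apply/seteqP; split => [t /= hy|t /= [[a b] [_ /= <-]] [/= -> ->]]//.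
by exists (s t, s' t) => //; split => //; split; exists t.
Qed.

Lemma strongly_measurable_comp2 (E F G : normedModType R) (h : E -> F -> G)
    (D : set R) (f : R -> E) (g : R -> F) :
  continuous (fun p : E * F => h p.1 p.2) ->
  strongly_measurable D f -> strongly_measurable D g ->
  strongly_measurable D (fun t => h (f t) (g t)).
Proof.
move=> hc [s ss sf] [s' ss' sg].
exists (fun n t => h (s n t) (s' n t)) => [n|t Dt].
  exact: simple_fun_comp2.
have := @cvg_comp _ _ _ (fun n => (s n t, s' n t)) (fun p => h p.1 p.2).
apply; last exact: (hc (f t, g t)).
by apply: cvg_pair; [exact: sf|exact: sg].
Qed.

Lemma simple_fun_cst (E : normedModType R) (y : E) : simple_fun (fun=> y).
Proof.
split=> [|z]; last by rewrite preimage_cst; case: ifP.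
by apply: (@sub_finite_set _ _ [set y]) => // _ [t _ <-].
Qed.

Lemma strongly_measurable_cst (E : normedModType R) (D : set R) (y : E) :
  strongly_measurable D (fun=> y).
Proof.
by exists (fun _ _ => y) => [n|t Dt]; [exact: simple_fun_cst|exact: cvg_cst].
Qed.

Lemma strongly_measurableR (D : set R) (f : R -> R^o) :
  measurable (D : set (measurableTypeR R)) -> strongly_measurable D f ->
  measurable_fun (D : set (measurableTypeR R)) (f : R -> R).
Proof.
move=> mD [s ss sf]; apply: (@measurable_realfun.measurable_fun_cvg _ _ _ D s) => // n.
apply: (@measurable_funS _ _ _ _ setT) => //.
have [fs ms] := ss n.
move=> _ B mB; rewrite setTI.
rewrite (_ : _ @^-1` _ = \bigcup_(y in range (s n) `&` B) (s n @^-1` [set y])).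
  apply: fin_bigcup_measurable => [|y _]; last exact: ms.
  by apply: sub_finite_set fs; exact: subIsetl.
apply/seteqP; split => [t /= Bt|t /= [y [_ By] /= ->]]//.
by exists (s n t) => //; split => //; exists t.
Qed.

End strongly_measurable.

Lemma dot_continuous (R : realType) (V : preHilbertType R) :
  continuous (fun p : V * V => dot p.1 p.2 : R^o).
Proof.
have -> : (fun p : V * V => dot p.1 p.2 : R^o) =
    (fun p => 4^-1 * (`|p.1 + p.2| ^+ 2 - `|p.1 - p.2| ^+ 2)).
  apply/funext => p.
  rewrite -!dot_norm -(scaleN1r p.2) !(dotDl, dotDr, dotZl, dotZr).
  by rewrite (dotC p.2 p.1) /=; field.
move=> p; apply: cvgM; first exact: cvg_cst.
under eq_fun do rewrite !expr2; rewrite !expr2.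
have cD : (q.1 + q.2) @[q --> p] --> p.1 + p.2.
  by apply: cvgD; [exact: cvg_fst|exact: cvg_snd].
have cB : (q.1 - q.2) @[q --> p] --> p.1 - p.2.
  by apply: cvgB; [exact: cvg_fst|exact: cvg_snd].
by apply: cvgB; apply: cvgM; apply: cvg_norm.
Qed.

Section ae.
Context {R : realType}.
Notation mu := (@lebesgue_measure R).

Let ae_filter : Filter (nbhs (almost_everywhere mu)).
Proof. exact: ae_filter_ringOfSetsType. Qed.

Lemma ae_imp (P Q : R -> Prop) : (forall t, P t -> Q t) ->
  (\forall t \ae mu, P t) -> \forall t \ae mu, Q t.
Proof. by move=> PQ; apply: filterS. Qed.

Lemma ae_imp2 (P Q S : R -> Prop) : (forall t, P t -> Q t -> S t) ->
  (\forall t \ae mu, P t) -> (\forall t \ae mu, Q t) -> \forall t \ae mu, S t.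
Proof. by move=> PQ; apply: filterS2. Qed.

End ae.

Section L2fun.
Context {R : realType} (T : R) (E : preHilbertType R).
Let D : set R := `]0, T[.
Notation mu := (@lebesgue_measure R).

Let mD : measurable (D : set (measurableTypeR R)). Proof. exact: measurable_itv. Qed.

Definition sq_integrable (f : R -> E) : Prop :=
  strongly_measurable D f /\ (\int[mu]_(t in D) (`|f t| ^+ 2)%:E < +oo)%E.

Definition sq_integrable_pred : {pred R -> E} := mem [set f | sq_integrable f].

Let dot_meas f g : strongly_measurable D f -> strongly_measurable D g ->
  measurable_fun (D : set (measurableTypeR R))
    (fun t => dot (f t : E) (g t) : R).
Proof.
move=> mf mg; apply: strongly_measurableR => //.
exact: (strongly_measurable_comp2 (@dot_continuous R E)).
Qed.

Let sq_int f : sq_integrable f ->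
  mu.-integrable D (fun t => (dot (f t) (f t))%:E).
Proof.
move=> [mf bf]; apply/integrableP; split.
  by apply/measurable_EFinP; exact: dot_meas.
apply: le_lt_trans bf; rewrite le_eqVlt; apply/orP; left; apply/eqP.
apply: eq_integral => t _.
by rewrite gee0_abs ?lee_fin ?dot_ge0// dot_norm.
Qed.

Lemma dot_integrable f g : sq_integrable f -> sq_integrable g ->
  mu.-integrable D (fun t => (dot (f t) (g t))%:E).
Proof.
move=> hf hg; have := integrableZl mD 2^-1 (integrableD mD (sq_int hf) (sq_int hg)).
apply: le_integrable => //.
  by apply/measurable_EFinP; apply: dot_meas; [case: hf|case: hg].
move=> t _; rewrite /= lee_fin (le_trans (dot_le_avg _ _))//.
by rewrite (le_trans _ (ler_norm _))// mulrC.
Qed.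

Lemma sq_integrable_submod : submod_closed sq_integrable_pred.
Proof.
split.
  apply/mem_set; split; first exact: strongly_measurable_cst.
  under eq_integral do rewrite /= normr0 expr0n.
  by rewrite integral0.
move=> a f g /set_mem hf /set_mem hg; apply/mem_set.
have [mf _] := hf; have [mg _] := hg.
split.
  apply: (@strongly_measurable_comp2 _ _ _ _ (fun x y => a *: x + y)) => //.
  move=> p; apply: cvgD; last exact: cvg_snd.
  by apply: cvgZr; exact: cvg_fst.
have ff := integrableZl mD (a ^+ 2) (dot_integrable hf hf).
have fg := integrableZl mD (2 * a) (dot_integrable hf hg).
have := integrableD mD (integrableD mD ff fg) (dot_integrable hg hg).
move/integrableP => [_]; apply: le_lt_trans.
apply: ge0_le_integral => //=.
- apply/measurable_EFinP; under eq_fun do rewrite -dot_norm.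
  apply: dot_meas.
  + apply: (@strongly_measurable_comp2 _ _ _ _ (fun x y => a *: x + y)) => //.
    move=> p; apply: cvgD; last exact: cvg_snd.
    by apply: cvgZr; exact: cvg_fst.
  + apply: (@strongly_measurable_comp2 _ _ _ _ (fun x y => a *: x + y)) => //.
    move=> p; apply: cvgD; last exact: cvg_snd.
    by apply: cvgZr; exact: cvg_fst.
- apply/measurable_EFinP; apply: measurableT_comp => //.
  apply: measurable_funD; last exact: dot_meas.
  by apply: measurable_funD; apply: measurable_funM => //; exact: dot_meas.
- move=> t _; rewrite lee_fin (le_trans _ (ler_norm _))//.
  rewrite -dot_norm !(dotDl, dotDr, dotZl, dotZr) (dotC (g t)).
  by rewrite le_eqVlt; apply/orP; left; apply/eqP; ring.
Qed.

HB.instance Definition _ :=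
  GRing.isSubmodClosed.Build R (R -> E) sq_integrable_pred sq_integrable_submod.

Record L2fun := MkL2fun {
  L2fun_val :> R -> E;
  L2fun_valP : L2fun_val \in sq_integrable_pred
}.

HB.instance Definition _ := [isSub for L2fun_val].
HB.instance Definition _ := [Choice of L2fun by <:].
HB.instance Definition _ := [SubChoice_isSubLmodule of L2fun by <:].

Definition L2null : {pred L2fun} :=
  mem [set f : L2fun | (f : R -> E) = (fun=> 0) %[ae mu in D]].

Lemma L2null_zmod_closed : zmod_closed L2null.
Proof.
split; first by apply/mem_set/aeW.
move=> f g /set_mem f0 /set_mem g0; apply/mem_set; move: f0 g0 => /=.
apply: ae_imp2 => t ft gt Dt; transitivity (f t - g t) => //.
by rewrite ft// gt// subrr.
Qed.

HB.instance Definition _ :=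
  GRing.isZmodClosed.Build L2fun L2null L2null_zmod_closed.

End L2fun.

(* The Bochner space L^2(0,T;E): classes, modulo a.e. equality on ]0, T[, of
   strongly measurable functions with square-integrable norm. *)
Definition L2 (R : realType) (T : R) (E : preHilbertType R) : Type :=
  Quotient.quot (@L2null R T E).

Section L2.
Context {R : realType} (T : R) (E : preHilbertType R).
Let D : set R := `]0, T[.
Notation mu := (@lebesgue_measure R).
Notation L2 := (L2 T E).
Local Open Scope quotient_scope.

Let mD : measurable (D : set (measurableTypeR R)).
Proof. exact: measurable_itv. Qed.

HB.instance Definition _ := EqQuotient.on L2.
HB.instance Definition _ := GRing.Zmodule.on L2.

Definition L2repr (x : L2) : R -> E := repr x.

Lemma L2repr_sq_integrable (x : L2) : sq_integrable T (L2repr x).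
Proof. exact: (set_mem (L2fun_valP (repr x))). Qed.

Lemma L2_pi_eq (f g : L2fun T E) :
  \pi_L2 f = \pi_L2 g <-> (f : R -> E) = g %[ae mu in D].
Proof.
have h : (f - g \in @L2null R T E) <-> (f : R -> E) = g %[ae mu in D].
  split => [/set_mem|fg].
    by apply: ae_imp => t fg Dt; apply/eqP; rewrite -subr_eq0; exact/eqP/fg.
  apply/mem_set; move: fg; apply: ae_imp => t fg Dt.
  by transitivity (f t - g t) => //; rewrite fg// subrr.
by rewrite -h Quotient.idealrBE; split => [->|/eqP].
Qed.

Lemma L2repr_pi (f : L2fun T E) : L2repr (\pi_L2 f) = f %[ae mu in D].
Proof. by apply/L2_pi_eq; rewrite reprK. Qed.

Lemma L2_eqP (x y : L2) : x = y <-> L2repr x = L2repr y %[ae mu in D].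
Proof.
rewrite /L2repr; split => [->|/L2_pi_eq]; first exact: aeW.
by rewrite !reprK.
Qed.

Lemma L2reprD (x y : L2) :
  L2repr (x + y) = (fun t => L2repr x t + L2repr y t) %[ae mu in D].
Proof.
have -> : x + y = \pi_L2 (repr x + repr y) by rewrite raddfD/= !reprK.
exact: L2repr_pi.
Qed.

Lemma L2repr0 : L2repr (0 : L2) = (fun=> 0) %[ae mu in D].
Proof. by rewrite -(raddf0 \pi_L2); exact: L2repr_pi. Qed.

Let scale (a : R) (x : L2) : L2 := \pi_L2 (a *: repr x).

Let L2repr_scale a x :
  L2repr (scale a x) = (fun t => a *: L2repr x t) %[ae mu in D].
Proof. exact: L2repr_pi. Qed.

Let scale_pi a (f : L2fun T E) : scale a (\pi_L2 f) = \pi_L2 (a *: f).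
Proof.
apply/L2_pi_eq; apply: ae_imp (L2repr_pi f) => t ft Dt.
exact: (congr1 (fun z => a *: z) (ft Dt)).
Qed.

Let scaleA a b x : scale a (scale b x) = scale (a * b) x.
Proof. by rewrite scale_pi scalerA. Qed.

Let scale1 : left_id 1 scale.
Proof. by move=> x; rewrite /scale scale1r reprK. Qed.

Let scaleDr : right_distributive scale +%R.
Proof.
move=> a x y; rewrite -[x]reprK -[y]reprK -raddfD !scale_pi/= -raddfD/=.
by rewrite scalerDr.
Qed.

Let scaleDl x : {morph scale^~ x : a b / a + b}.
Proof. by move=> a b; rewrite /scale scalerDl raddfD. Qed.

HB.instance Definition _ :=
  GRing.Zmodule_isLmodule.Build R L2 scaleA scale1 scaleDr scaleDl.

Lemma L2reprZ a (x : L2) :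
  L2repr (a *: x) = (fun t => a *: L2repr x t) %[ae mu in D].
Proof. exact: L2repr_scale. Qed.

End L2.

HB.lock Definition L2dot (R : realType) (T : R) (E : preHilbertType R)
    (x y : L2 T E) : R :=
  \int[@lebesgue_measure R]_(t in `]0, T[) dot (L2repr x t) (L2repr y t).
Canonical L2dot_unlockable := Unlockable L2dot.unlock.

Section L2_preHilbert.
Context {R : realType} (T : R) (E : preHilbertType R).
Let D : set R := `]0, T[.
Notation mu := (@lebesgue_measure R).
Notation L2 := (L2 T E).

Let mD : measurable (D : set (measurableTypeR R)).
Proof. exact: measurable_itv. Qed.

Let integrable_repr (x y : L2) :
  mu.-integrable D (fun t => (dot (L2repr x t) (L2repr y t))%:E).
Proof. by apply: dot_integrable; exact: L2repr_sq_integrable. Qed.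

Let ae_Rintegral (f g : R -> R) :
  mu.-integrable D (EFin \o f) -> mu.-integrable D (EFin \o g) ->
  f = g %[ae mu in D] -> \int[mu]_(t in D) f t = \int[mu]_(t in D) g t.
Proof.
move=> /measurable_int mf /measurable_int mg fg.
congr fine; apply: ae_eq_integral => //.
by move: fg; apply: ae_imp => t fg Dt /=; rewrite fg.
Qed.

Let dotC_ (x y : L2) : L2dot x y = L2dot y x.
Proof. by rewrite !unlock; apply: eq_Rintegral => t _; rewrite dotC. Qed.

Let dotDl_ (x y z : L2) : L2dot (x + y) z = L2dot x z + L2dot y z.
Proof.
rewrite !unlock -RintegralD//; [|exact: integrable_repr..].
apply: ae_Rintegral; first exact: integrable_repr.
  exact: (integrableD mD (integrable_repr x z) (integrable_repr y z)).
by apply: ae_imp (L2reprD x y) => t xy Dt; rewrite xy// dotDl.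
Qed.

Let dotZl_ a (x y : L2) : L2dot (a *: x) y = a * L2dot x y.
Proof.
rewrite !unlock -RintegralZl//; last exact: integrable_repr.
apply: ae_Rintegral; first exact: integrable_repr.
  exact: (integrableZl mD a (integrable_repr x y)).
by apply: ae_imp (L2reprZ a x) => t xy Dt; rewrite xy// dotZl.
Qed.

Let dot_ge0_ (x : L2) : 0 <= L2dot x x.
Proof. by rewrite unlock; apply: Rintegral_ge0 => t _; exact: dot_ge0. Qed.

Let dot_eq0_ (x : L2) : L2dot x x = 0 -> x = 0.
Proof.
rewrite unlock => x0; apply/L2_eqP.
have /integrableP[mx xoo] := integrable_repr x x.
have : (\int[mu]_(t in D) `|(dot (L2repr x t) (L2repr x t))%:E| = 0)%E.
  rewrite -[LHS]fineK; last by rewrite ge0_fin_numE// integral_ge0.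
  rewrite -[X in _ = X]/(0%:E) -x0; congr EFin; congr fine.
  by apply: eq_integral => t _; rewrite gee0_abs// lee_fin dot_ge0.
move/(ae_eq_integral_abs mu mD mx) => xx0.
apply: ae_imp2 xx0 (L2repr0 T E) => t xt t0 Dt; rewrite t0//.
by apply: dot_eq0; case: (xt Dt).
Qed.

HB.instance Definition _ := Lmodule_isPreHilbert.Build R L2
  dotC_ dotDl_ dotZl_ dot_ge0_ dot_eq0_.

Lemma L2dotE (x y : L2) :
  dot x y = \int[mu]_(t in D) dot (L2repr x t) (L2repr y t).
Proof. by rewrite -[LHS]/(L2dot x y) unlock. Qed.

End L2_preHilbert.

(* A Gelfand triple U -> H -> U*. [Us] plays the role of the dual of [U]: the
   last two axioms say that [gpair] identifies [Us] isometrically with the space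
   of bounded linear functionals on [U].  The embedding of [H] into [Us] is the
   transpose of [gemb], so that <h, v> = (h, gemb v)_H for h in H and v in U. *)
Record gelfand (R : realType) (U H Us : hilbertType R) := Gelfand {
  gemb : {linear U -> H};
  gemb_continuous : continuous gemb;
  gemb_inj : injective gemb;
  gemb_dense : dense (range gemb);
  gpair : {bilinear Us -> U -> R^o};
  gpair_norm : forall w, opnorm (gpair w : U -> R^o) = `|w|%:E;
  gpair_surj : forall l : {linear U -> R^o}, continuous l ->
    exists w, forall v, gpair w v = l v
}.

Definition test_function (R : realType) (T : R) (phi : R -> R) : Prop :=
  (forall n t, derivable (derive1n n phi) t 1) /\
  exists a b, [/\ 0 < a, b < T & forall t, t \notin `[a, b] -> phi t = 0].

Section evolution_space.
Context {R : realType} (T : R) {U H Us : hilbertType R} (G : gelfand U H Us).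
Let D : set R := `]0, T[.
Notation mu := (@lebesgue_measure R).

Let mD : measurable (D : set (measurableTypeR R)).
Proof. exact: measurable_itv. Qed.

(* [w] is the derivative of [u] in the sense of U*-valued distributions, tested
   against v in U: <w, v> is the distributional derivative of <u, v>, where
   <u, v> = (u, v)_H. *)
Definition weak_derivative (u : L2 T U) (w : L2 T Us) : Prop :=
  forall (v : U) (phi : R -> R), test_function T phi ->
    \int[mu]_(t in D) (gpair G (L2repr w t) v * phi t) =
    - \int[mu]_(t in D) (dot (gemb G (L2repr u t)) (gemb G v) * derive1 phi t).

Let test_int (E : preHilbertType R) (L : {linear E -> R^o}) (phi : R -> R)
    (x : L2 T E) :
  continuous L -> continuous phi ->
  mu.-integrable D (EFin \o (fun t => L (L2repr x t) * phi t)).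
Proof.
move=> Lc phic.
have [C Lb] : exists C, forall y, `|L y| <= C * `|y|.
  have /linear_boundedP Lb := continuous_linear_bounded 0 (Lc 0).
  by near +oo_R => C; exists C; near: C.
have [mx _] := L2repr_sq_integrable x.
have xx := integrableZl mD (C ^+ 2)
  (dot_integrable (L2repr_sq_integrable x) (L2repr_sq_integrable x)).
have pp : mu.-integrable D (EFin \o (fun t => phi t ^+ 2)).
  apply: (@integrableS _ _ _ mu `[0, T]) => //.
    by apply: subset_itvW.
  apply: continuous_compact_integrable; first exact: segment_compact.
  apply: continuous_subspaceT => t; under eq_fun do rewrite expr2.
  by apply: cvgM; exact: phic.
have mphi : measurable_fun (D : set (measurableTypeR R)) phi.
  apply: measurable_funTS; exact: continuous_measurable_fun.
apply: le_integrable (integrableD mD xx pp) => //.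
  apply/measurable_EFinP; apply: measurable_funM => //.
  apply: (@strongly_measurableR _ _ (fun t => L (L2repr x t))) => //.
  apply: (@strongly_measurable_comp2 _ _ _ _ (fun y _ => L y) _ _ _ _ mx mx).
  by move=> p; apply: continuous_comp; [exact: cvg_fst|exact: Lc].
move=> t _; rewrite /= lee_fin normrM dot_norm -exprMn.
rewrite (le_trans _ (ler_norm _))// -(real_normK (num_real (phi t))).
have := Lb (L2repr x t); have := normr_ge0 (L (L2repr x t)).
have := normr_ge0 (phi t).
move: `|phi t| `|L _| (C * _) => c a b c0 a0 ab.
have : a * c <= b * c by rewrite ler_wpM2r.
have := sqr_ge0 (b - c); have := sqr_ge0 b; have := sqr_ge0 c; nra.
Unshelve. all: by end_near. Qed.

Let gpair_le w v : `|gpair G w v| <= `|w| * `|v|.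
Proof.
have [->|v0] := eqVneq v 0; first by rewrite raddf0 !normr0 mulr0.
have nv : 0 < `|v| by rewrite normr_gt0.
have : (`|gpair G w (`|v|^-1 *: v)|%:E <= `|w|%:E)%E.
  rewrite -(gpair_norm G); apply: ereal_sup_ubound.
  exists (`|v|^-1 *: v) => //=.
  by rewrite normrZ normfV normr_id mulVf// gt_eqF.
rewrite lee_fin linearZ/= normrZ normfV normr_id.
by rewrite ler_pdivrMl// mulrC.
Qed.

Let gpairl (v : U) : {linear Us -> R^o} := applyr (gpair G) v.

Let gpairl_continuous v : continuous (gpairl v).
Proof.
apply: bounded_linear_continuous; apply/linear_boundedP.
near=> r => w; rewrite (le_trans (gpair_le w v))// mulrC ler_wpM2r//.
Unshelve. all: by end_near. Qed.

Let dotl (v : U) (u : U) : R^o := dot (gemb G u) (gemb G v).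

Let dotl_linear v : linear (dotl v).
Proof. by move=> a x y; rewrite /dotl linearP dotDl dotZl. Qed.

HB.instance Definition _ v :=
  GRing.isLinear.Build R U R^o _ (dotl v) (dotl_linear v).

Let dotl_continuous v : continuous (dotl v).
Proof.
move=> u.
have := @continuous_comp _ _ _ (fun x => (gemb G x, gemb G v))
  (fun p : H * H => dot p.1 p.2 : R^o) u.
apply; last exact: dot_continuous.
by apply: cvg_pair; [exact: gemb_continuous|exact: cvg_cst].
Qed.

Let test_continuous phi : test_function T phi -> continuous phi.
Proof.
move=> [dphi _] t; apply: differentiable_continuous.
by apply/derivable1_diffP; exact: (dphi 0%N).
Qed.

Let dtest_continuous phi : test_function T phi -> continuous (derive1 phi).
Proof.
move=> [dphi _] t; apply: differentiable_continuous.
by apply/derivable1_diffP; exact: (dphi 1%N).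
Qed.

Let ae_Rintegral (f g : R -> R) :
  mu.-integrable D (EFin \o f) -> mu.-integrable D (EFin \o g) ->
  f = g %[ae mu in D] -> \int[mu]_(t in D) f t = \int[mu]_(t in D) g t.
Proof.
move=> /measurable_int mf /measurable_int mg fg.
congr fine; apply: ae_eq_integral => //.
by move: fg; apply: ae_imp => t fg Dt /=; rewrite fg.
Qed.

Let test_lin (E : preHilbertType R) (L : {linear E -> R^o}) (phi : R -> R)
    (a : R) (x y : L2 T E) : continuous L -> continuous phi ->
  \int[mu]_(t in D) (L (L2repr (a *: x + y) t) * phi t) =
  a * \int[mu]_(t in D) (L (L2repr x t) * phi t) +
  \int[mu]_(t in D) (L (L2repr y t) * phi t).
Proof.
move=> Lc phic.
have hx := test_int x Lc phic; have hy := test_int y Lc phic.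
have hax := integrableZl mD a hx.
rewrite -RintegralZl// -RintegralD//.
apply: ae_Rintegral; [exact: test_int|exact: (integrableD mD hax hy)|].
apply: ae_imp2 (L2reprD (a *: x) y) (L2reprZ a x) => t xy ax Dt.
by rewrite xy// ax// linearP/= mulrDl mulrA.
Qed.

Definition evolution_pred : {pred hprod (L2 T U) (L2 T Us)} :=
  mem [set p | weak_derivative p.1 p.2].

Lemma evolution_submod_closed : submod_closed evolution_pred.
Proof.
have lin a p q : weak_derivative p.1 p.2 -> weak_derivative q.1 q.2 ->
    weak_derivative (a *: p.1 + q.1) (a *: p.2 + q.2).
  move=> hp hq v phi tphi.
  have := test_lin a p.2 q.2 (@gpairl_continuous v) (test_continuous tphi).
  have := test_lin a p.1 q.1 (@dotl_continuous v) (dtest_continuous tphi).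
  by rewrite /= /dotl /applyr_head => -> ->; rewrite hp// hq// mulrN -opprD.
split; last by move=> a p q /set_mem hp /set_mem hq; exact/mem_set/lin.
apply/mem_set => v phi tphi.
have := test_lin (-1) 0 0 (@gpairl_continuous v) (test_continuous tphi).
rewrite scaler0 addr0 mulN1r addNr /= => ->.
have := test_lin (-1) 0 0 (@dotl_continuous v) (dtest_continuous tphi).
by rewrite scaler0 addr0 mulN1r addNr /= /dotl => ->; rewrite oppr0.
Qed.

HB.instance Definition _ := GRing.isSubmodClosed.Build R
  (hprod (L2 T U) (L2 T Us)) evolution_pred evolution_submod_closed.

(* {u in L^2(0,T;U) : u' in L^2(0,T;Us)}, encoded as the graph of the weak time
   derivative, i.e. as the pairs (u, u'); since u determines u', this is the
   same space, and the norm inherited from the product is the graph norm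
   |u|^2 = |u|_{L^2(U)}^2 + |u'|_{L^2(Us)}^2. *)
Record evolution := Evolution {
  evolution_val : hprod (L2 T U) (L2 T Us);
  evolution_valP : evolution_val \in evolution_pred
}.

HB.instance Definition _ := [isSub for evolution_val].
HB.instance Definition _ := [Choice of evolution by <:].
HB.instance Definition _ := [SubChoice_isSubLmodule of evolution by <:].

Definition state (u : evolution) : L2 T U := (evolution_val u).1.
Definition ddt (u : evolution) : L2 T Us := (evolution_val u).2.

Let form (u v : evolution) : R := dot (state u) (state v) + dot (ddt u) (ddt v).

Let formE u v : form u v = dot (evolution_val u) (evolution_val v).
Proof. by []. Qed.

Let formC u v : form u v = form v u.
Proof. by rewrite !formE dotC. Qed.

Let formDl u v w : form (u + v) w = form u w + form v w.
Proof. by rewrite !formE -dotDl. Qed.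

Let formZl a u v : form (a *: u) v = a * form u v.
Proof. by rewrite !formE -dotZl. Qed.

Let form_ge0 u : 0 <= form u u.
Proof. by rewrite formE dot_ge0. Qed.

Let form_eq0 u : form u u = 0 -> u = 0.
Proof. by rewrite formE => /dot_eq0 u0; exact: val_inj. Qed.

HB.instance Definition _ := Lmodule_isPreHilbert.Build R evolution
  formC formDl formZl form_ge0 form_eq0.

Lemma evolution_dotE (u v : evolution) :
  dot u v = dot (state u) (state v) + dot (ddt u) (ddt v).
Proof. by []. Qed.

(* The value at t = 0 of the representative of [u] in C([0, T]; H), which exists
   by the embedding of the evolution space into C([0, T]; H) and is unique. *)
Definition trace0 (u : evolution) : H :=
  xget 0 [set h | exists w : R -> H, [/\ {within `[0, T], continuous w},
    w = (fun t => gemb G (L2repr (state u) t)) %[ae mu in D] & w 0 = h]].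

End evolution_space.

Section state_operator.
Context {R : realType} (T : R) {X U H Us : hilbertType R} (G : gelfand U H Us).
Let D : set R := `]0, T[.
Notation mu := (@lebesgue_measure R).
Implicit Types (f : R -> X -> U -> Us) (th : X) (u : evolution T G).

Definition caratheodory f : Prop :=
  (forall th y, exists2 g : R -> Us, strongly_measurable D g &
     (fun t => f t th y) = g %[ae mu in D]) /\
  (\forall t \ae mu, D t -> continuous (fun p : X * U => f t p.1 p.2)).

Definition is_nemytskii f th u (w : L2 T Us) : Prop :=
  L2repr w = (fun t => f t th (L2repr (state u) t)) %[ae mu in D].

Definition induces_nemytskii f : Prop :=
  forall th u, exists w, is_nemytskii f th u w.

(* Unique when it exists: [is_nemytskii] determines [w] up to a.e. equality. *)
Definition nemytskii f th u : L2 T Us := xget 0 [set w | is_nemytskii f th u w].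

Definition state_operator (A : X -> H) f th u : hprod (L2 T Us) H :=
  (ddt u + nemytskii f th u, A th - trace0 u).

End state_operator.

Definition landweber (R : realType) (V W : preHilbertType R) (F : V -> W)
    (y : W) (u : nat -> V) : Prop :=
  forall k, u k.+1 = u k - adjoint ('d F (u k)) (F (u k) - y).

(* Main.v *)
Require Import Defs.
From mathcomp Require Import all_boot all_order all_algebra.
From mathcomp Require Import all_classical all_reals all_analysis.
From mathcomp Require Import measurable_realfun ring lra.

(** Fix theta and let s be a solution of F(u) = phi in the ball B_r(ud).
    Expanding the square and moving the adjoint to the other side gives
      |u_(k+1) - s|^2 = |u_k - s|^2 - 2 (F(u_k) - phi, F'(u_k)(u_k - s))
                        + |F'(u_k)^* (F(u_k) - phi)|^2,
    where the cone condition makes the middle term at most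
    -(M^2 + mu) |F(u_k) - phi|^2 and the bound on the derivative makes the last
    one at most M^2 |F(u_k) - phi|^2 ([landweber_step]).  Hence the distance to
    every solution decreases, by at least mu |F(u_k) - phi|^2 in the square.
    With s the solution near u_0 the iterates stay in the ball and the squared
    residuals are summable.

    Weak convergence is Opial's argument ([fejer_weak_cvg]).  A weak limit a of
    the iterates solves the equation ([weak_limit_solution]): in the cone
    condition at the pair (a, u_k) the left-hand side tends to 0, because
    F(u_k) tends to phi in norm while F'(a)(a - u_k) tends weakly to 0, and the
    right-hand side tends to (M^2 + mu) |F(a) - phi|^2.  Two weak limits are
    solutions to which the distances of the iterates both converge, and this
    forces them to coincide.  Weak limits are taken along ultrafilters, which
    exist without separability: each sequence (z, u_k) has a limit, these limits
    form a bounded functional of z, and Riesz represents it.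

    For the rate, coercivity turns the summable residuals into the summable
    quantities |u_k - us|^(2 alpha), us being the solution near u_0; they
    decrease, so k |u_k - us|^(2 alpha) is at most the sum of the first k of them
    ([landweber_rate]).  The cone condition also makes F Lipschitz on the ball
    ([lipschitz_of_cone]), so the residual inherits the rate.

    Both the adjoint and the weak limits rest on the Riesz representation theorem,
    hence on the completeness of the evolution space.  It is proved in two steps:
    L^2(0,T;E) is complete for every Hilbert space E (Riesz-Fischer for
    Bochner-measurable functions, [L2_rapidly_complete]), and being a weak
    derivative is a condition of orthogonality type, thus closed
    ([weak_derivative_dot], [evolution_rapidly_complete]). *)

Import Order.TTheory GRing.Theory Num.Theory.
Import numFieldNormedType.Exports.

Local Open Scope classical_set_scope.
Local Open Scope ring_scope.

(** * The Riesz representation and adjoints *)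

Section hilbert.
Context {R : realType}.

(** Equivalent to completeness, since every Cauchy sequence has a subsequence of
    this kind.  Asking only for these sequences removes the extraction of
    subsequences from every proof below, and their steps are summable. *)
Definition rapidly_complete (V : normedModType R) : Prop :=
  forall u : nat -> V, (forall n, `|u n.+1 - u n| <= 2^-1 ^+ n) ->
    exists l : V, u n @[n --> \oo] --> l.

Lemma sqr_norm_addZ {V : preHilbertType R} (t : R) (x y : V) :
  `|x + t *: y| ^+ 2 = `|x| ^+ 2 + 2 * t * dot x y + t ^+ 2 * `|y| ^+ 2.
Proof.
rewrite -!dot_norm !(dotDl, dotDr, dotZl, dotZr) (dotC y x); ring.
Qed.

Lemma sqr_normB {V : preHilbertType R} (x y : V) :
  `|x - y| ^+ 2 = `|x| ^+ 2 - 2 * dot x y + `|y| ^+ 2.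
Proof. by rewrite -scaleN1r sqr_norm_addZ; ring. Qed.

Lemma dotBl {V : preHilbertType R} (x y z : V) :
  dot (x - y) z = dot x z - dot y z.
Proof. by rewrite dotDl dotNl. Qed.

Lemma dotBr {V : preHilbertType R} (x y z : V) :
  dot x (y - z) = dot x y - dot x z.
Proof. by rewrite dotC dotBl !(dotC x). Qed.

Lemma cauchy_schwarz {V : preHilbertType R} (x y : V) :
  `|dot x y| <= `|x| * `|y|.
Proof.
rewrite -(@ler_pXn2r _ 2)// ?nnegrE ?mulr_ge0// real_normK ?num_real//.
have [->|y0] := eqVneq y 0.
  by rewrite dotC dot0l expr0n normr0 mulr0 expr0n.
have yp : 0 < `|y| ^+ 2 by rewrite exprn_gt0// normr_gt0.
(* |y|^2 times the difference of the two sides is the square of this norm. *)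
have := sqr_ge0 `|(`|y| ^+ 2) *: x + (- dot x y) *: y|.
rewrite sqr_norm_addZ normrZ dotZl ger0_norm ?sqr_ge0// exprMn.
set a := `|y| in yp *; set b := `|x|; set c := dot x y => h.
rewrite -(ler_pM2l yp); nra.
Qed.

Lemma dot_cvgr {V : preHilbertType R} {I : Type} {F : set_system I}
    {FF : Filter F} (x : V) (u : I -> V) (l : V) :
  u n @[n --> F] --> l -> dot x (u n) @[n --> F] --> (dot x l : R).
Proof.
move=> ul.
have h : (x, u n) @[n --> F] --> (x, l) by apply: cvg_pair => //; exact: cvg_cst.
exact: (@cvg_comp _ _ _ _ _ _ _ _ h (@dot_continuous R V (x, l))).
Qed.

(** The representative is the minimiser of J(x) = |x|^2 - 2 l(x).  Minimising
    sequences converge by the parallelogram law, and at a minimiser w the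
    derivative 2 ((x, w) - l(x)) of J in every direction x vanishes. *)
Lemma riesz_representation (V : preHilbertType R) (l : V -> R) (C : R) :
  rapidly_complete V ->
  (forall a x y, l (a *: x + y) = a * l x + l y) ->
  (forall x, `|l x| <= C * `|x|) ->
  exists w, forall x, l x = dot x w.
Proof.
move=> cV lin bnd.
pose J x := `|x| ^+ 2 - 2 * l x.
have JP a x z : J (x + a *: z) =
    J x + 2 * a * (dot x z - l z) + a ^+ 2 * `|z| ^+ 2.
  by rewrite /J sqr_norm_addZ [x + _]addrC lin; ring.
pose S := range J.
have hS : has_inf S.
  split; first by exists (J 0), 0.
  exists (- C ^+ 2) => _ [x _ <-]; rewrite /J.
  have := bnd x; rewrite ler_norml => /andP[_ h].
  have := sqr_ge0 (`|x| - C); rewrite sqrrB; set a := `|x| in h *; lra.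
have JS x : inf S <= J x by apply: inf_lbound; [case: hS|exists x].
(* J within 4^-1 4^-n of its infimum puts consecutive v_n within 2^-n. *)
have /(_ _)/cid-/all_sig[v vP] n : exists x, J x < inf S + 4^-1 * 4^-1 ^+ n.
  have e0 : 0 < 4^-1 * 4^-1 ^+ n :> R by rewrite mulr_gt0// exprn_gt0.
  by have [_ [x _ <-] Jx] := inf_adherent e0 hS; exists x.
have [|w vw] := cV v.
  move=> n; rewrite -(@ler_pXn2r _ 2)// ?nnegrE ?exprn_ge0// -exprM mulnC exprM.
  have q4 : 2^-1 ^+ 2 = 4^-1 :> R by field.
  rewrite q4; have h1 := vP n; have h2 := vP n.+1.
  (* The parallelogram law: J at the midpoint, still at least its infimum, is
     the mean of J at the ends minus a quarter of the squared distance. *)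
  have h3 := JS (v n + 2^-1 *: (v n.+1 - v n)).
  have e0 : 0 < 4^-1 ^+ n :> R by rewrite exprn_gt0.
  have h4 := JP 1 (v n) (v n.+1 - v n).
  rewrite scale1r subrKC in h4; rewrite JP q4 in h3.
  rewrite exprS in h2; rewrite expr1n mul1r mulr1 in h4.
  move: (`|v n.+1 - v n| ^+ 2) (4^-1 ^+ n) (dot _ _ - _) h1 h2 h3 h4 e0 => a b c.
  lra.
exists w => x.
have Jw : J w <= inf S.
  have cvJ : J (v n) @[n --> \oo] --> J w.
    apply: cvgB.
      by rewrite expr2; under eq_fun do rewrite expr2; apply: cvgM; exact: cvg_norm.
    apply: cvgM; first exact: cvg_cst.
    apply/cvgrPdist_lt => e e0.
    have C1 : 0 < `|C| + 1 by rewrite ltr_wpDl.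
    have /cvgrPdist_lt/(_ (e / (`|C| + 1))) := vw.
    move=> /(_ (divr_gt0 e0 C1)); apply: filterS => n.
    rewrite ltr_pdivlMr//; apply: le_lt_trans.
    have -> : l w - l (v n) = l (w - v n).
      have := lin 1 (w - v n) (v n); rewrite scale1r subrK mul1r => ->; ring.
    rewrite (le_trans (bnd _))// mulrC ler_wpM2l// (le_trans (ler_norm _))//.
    by rewrite lerDl.
  have cve : inf S + 4^-1 * 4^-1 ^+ n @[n --> \oo] --> inf S + 4^-1 * 0.
    apply: cvgD; first exact: cvg_cst.
    apply: cvgM; first exact: cvg_cst.
    by apply: cvg_expr; rewrite ger0_norm// invf_lt1//; lra.
  rewrite mulr0 addr0 in cve.
  by apply: (ler_cvg_to cvJ cve); near=> n; exact: ltW.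
rewrite dotC; apply/eqP; rewrite eq_sym -subr_eq0; apply/eqP.
set d := _ - _.
have key a : 0 <= 2 * a * d + a ^+ 2 * `|x| ^+ 2.
  have := JS (w + a *: x); rewrite JP -/d; move: Jw; lra.
have x2 : 0 <= `|x| ^+ 2 by exact: sqr_ge0.
(* The quadratic in [key] is minimal at - d / |x|^2; adding 1 to the denominator
   also covers x = 0. *)
have := key (- d / (`|x| ^+ 2 + 1)); set s := `|x| ^+ 2 in x2 *.
have s1 : 0 < s + 1 by lra.
have -> : 2 * (- d / (s + 1)) * d + (- d / (s + 1)) ^+ 2 * s =
  - (d ^+ 2 * (s + 2) / (s + 1) ^+ 2) by field; lra.
rewrite oppr_ge0 pmulr_lle0 ?invr_gt0 ?exprn_gt0// => h.
have : d ^+ 2 <= 0 by have := sqr_ge0 d; nra.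
move=> h'; apply/eqP; rewrite -sqrf_eq0 eq_le h'; exact: sqr_ge0.
Unshelve. all: by end_near. Qed.

Lemma opnorm_le {V W : normedModType R} (L : {linear V -> W}) (M : R) :
  (opnorm L <= M%:E)%E -> forall v, `|L v| <= M * `|v|.
Proof.
move=> LM v; have [->|v0] := eqVneq v 0; first by rewrite raddf0 !normr0 mulr0.
have nv : 0 < `|v| by rewrite normr_gt0.
have : (`|L (`|v|^-1 *: v)|%:E <= M%:E)%E.
  apply: le_trans LM; apply: ereal_sup_ubound.
  exists (`|v|^-1 *: v) => //=.
  by rewrite normrZ normfV normr_id mulVf// gt_eqF.
rewrite lee_fin linearZ/= normrZ normfV normr_id.
by rewrite ler_pdivrMl// mulrC.
Qed.

(** [adjoint] is chosen among the representatives of the functionals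
    (L _, w), and Riesz provides one. *)
Lemma adjointP {V W : preHilbertType R} (L : {linear V -> W}) (M : R) :
  rapidly_complete V -> (forall v, `|L v| <= M * `|v|) ->
  forall v w, dot (L v) w = dot v (adjoint L w).
Proof.
move=> cV LM v w.
suff ex : exists a, [set a | forall z, dot (L z) w = dot z a] a.
  exact: (xgetPex 0 ex v).
have [|x|a h] := @riesz_representation V (fun v => dot (L v) w) (M * `|w|) cV.
- by move=> a x y; rewrite linearP dotDl dotZl.
- by rewrite (le_trans (cauchy_schwarz _ _))// mulrAC ler_wpM2r.
- by exists a.
Qed.

Lemma adjoint_le {V W : preHilbertType R} (L : {linear V -> W}) (M : R) w :
  rapidly_complete V -> 0 <= M -> (forall v, `|L v| <= M * `|v|) ->
  `|adjoint L w| <= M * `|w|.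
Proof.
move=> cV M0 LM; set a := adjoint L w.
have h : `|a| ^+ 2 <= M * `|a| * `|w|.
  rewrite -dot_norm -(adjointP L M cV LM) (le_trans (ler_norm _))//.
  by rewrite (le_trans (cauchy_schwarz _ _))// ler_wpM2r.
have [->|a0] := eqVneq `|a| 0; first by rewrite mulr_ge0.
have ap : 0 < `|a| by rewrite lt0r a0/=.
by rewrite -(ler_pM2r ap) -expr2 mulrAC.
Qed.

End hilbert.

(** * Weak limits along ultrafilters *)

Section weak_convergence.
Context {R : realType}.

Lemma bounded_ultra_cvg (U : set_system nat) (C : R) (f : nat -> R) :
  UltraFilter U -> (forall n, `|f n| <= C) -> exists l : R, f n @[n --> U] --> l.
Proof.
move=> UU fC.
have Uf : U (f @^-1` [set` `[- C, C]]).
  by apply: (@filterE _ U) => n; rewrite /= in_itv/= -ler_norml.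
have [p [_ fp]] :=
  @segment_compact R (- C) C (f @ U) (fmap_proper_filter f ultra_proper) Uf.
exists p => B Bp.
case: (@in_ultra_setVsetC nat U (f @^-1` B) UU) => // UnB.
by have [x []] := fp _ _ (UnB : (f @ U) (~` B)) Bp.
Qed.

(** Weak compactness of bounded sets, for sequences and without separability: the
    limits along U of the numbers (z, u_n) depend linearly and boundedly on z. *)
Lemma bounded_ultra_weak_cvg {V : preHilbertType R} (U : set_system nat) (C : R)
    (u : nat -> V) :
  rapidly_complete V -> UltraFilter U -> (forall n, `|u n| <= C) ->
  exists a, forall z, dot z (u n) @[n --> U] --> (dot z a : R).
Proof.
move=> cV UU uC.
have /(_ _)/cid-/all_sig[l lP] z : exists l : R, dot z (u n) @[n --> U] --> l.
  apply: (@bounded_ultra_cvg _ (`|z| * C)) => n.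
  by rewrite (le_trans (cauchy_schwarz _ _))// ler_wpM2l.
have [b x y|x|a la] := @riesz_representation R V l C cV.
- have := lP (b *: x + y); under eq_fun do rewrite dotDl dotZl.
  move/cvg_unique; apply => //.
  by apply: cvgD (lP y); apply: cvgM (lP x); exact: cvg_cst.
- apply: ler_cvg_to (cvg_norm (lP x)) (cvg_cst (C * `|x|)) _.
  apply: filterE => n; rewrite mulrC.
  by rewrite (le_trans (cauchy_schwarz _ _))// ler_wpM2l.
- by exists a => z; rewrite -la.
Qed.

Lemma weak_limit_ball {V : preHilbertType R} (U : set_system nat) (a c : V)
    (r : R) (u : nat -> V) :
  ProperFilter U -> 0 <= r -> (forall n, `|u n - c| <= r) ->
  (forall z, dot z (u n) @[n --> U] --> (dot z a : R)) -> `|a - c| <= r.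
Proof.
move=> PU r0 ur ua.
have h : `|a - c| ^+ 2 <= `|a - c| * r.
  rewrite -dot_norm.
  have h : dot (a - c) (u n - c) @[n --> U] --> (dot (a - c) (a - c) : R).
    rewrite [X in _ --> X]dotBr; under eq_fun do rewrite dotBr.
    by apply: cvgB; [exact: ua|exact: cvg_cst].
  apply: (ler_cvg_to h (cvg_cst _)); apply: (@filterE _ U) => n.
  rewrite (le_trans (ler_norm _))// (le_trans (cauchy_schwarz _ _))//.
  by rewrite ler_wpM2l.
have [->//|ac0] := eqVneq `|a - c| 0.
have ac : 0 < `|a - c| by rewrite lt0r ac0/=.
by rewrite -(ler_pM2l ac) -expr2.
Qed.

(** If f fails to converge to l along F, the points where f misses some
    neighbourhood of l form a set compatible with F, and an ultrafilter containing
    both F and this set is a counterexample. *)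
Lemma cvg_ultra {I : Type} {T : topologicalType} (F : set_system I) (f : I -> T)
    (l : T) : ProperFilter F ->
  (forall U, UltraFilter U -> F `<=` U -> f n @[n --> U] --> l) ->
  f n @[n --> F] --> l.
Proof.
move=> PF h B Bl; apply: contrapT => nFB.
pose G := within (f @^-1` (~` B)) F.
have PG : ProperFilter G.
  apply: Build_ProperFilter_ex => P GP.
  apply: contrapT => nP; apply: nFB; suff : F (f @^-1` B) by [].
  apply: (@filterS _ F _ _ _ _ GP) => i iP.
  by apply: contrapT => nB; apply: nP; exists i; exact: iP.
have [U [UU GU]] := ultraFilterLemma PG.
have FU : F `<=` U.
  by move=> P FP; apply: GU; apply: (@filterS _ F _ _ _ _ FP) => ? ?.
have UB := h U UU FU B Bl.
have UnB : U (f @^-1` (~` B)) by apply: GU; exact: withinT.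
by have [i []] := filter_ex (filterI UB UnB).
Qed.

(** Opial's lemma.  The distances from u_n to two weak cluster points a and b both
    converge, and |u_n - b|^2 - |u_n - a|^2 is affine in (a - b, u_n); so
    (a - b, u_n) converges, its limit is (a - b, a) along one ultrafilter and
    (a - b, b) along the other, and |a - b|^2 = 0. *)
Lemma fejer_weak_cvg {V : preHilbertType R} (S : set V) (C : R) (u : nat -> V) :
  rapidly_complete V -> (forall n, `|u n| <= C) ->
  (forall s, S s -> forall n, `|u n.+1 - s| <= `|u n - s|) ->
  (forall U a, UltraFilter U -> \oo `<=` U ->
    (forall z, dot z (u n) @[n --> U] --> (dot z a : R)) -> S a) ->
  exists2 a, S a & weakly_cvg u a.
Proof.
move=> cV uC fejer wS.
have dist s : S s -> exists e : R, `|u n - s| ^+ 2 @[n --> \oo] --> e.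
  move=> Ss; apply/cvg_ex; apply: nonincreasing_is_cvgn.
    apply/nonincreasing_seqP => n.
    by rewrite ler_pXn2r ?nnegrE ?fejer.
  by exists 0 => _ [n _ <-]; exact: sqr_ge0.
have uniq U U' a b : UltraFilter U -> UltraFilter U' ->
    \oo `<=` U -> \oo `<=` U' ->
    (forall z, dot z (u n) @[n --> U] --> (dot z a : R)) ->
    (forall z, dot z (u n) @[n --> U'] --> (dot z b : R)) -> a = b.
  move=> UU UU' oU oU' ua ub.
  have [ea ua'] := dist a (wS _ _ UU oU ua).
  have [eb ub'] := dist b (wS _ _ UU' oU' ub).
  have [d dP] : exists d : R, dot (a - b) (u n) @[n --> \oo] --> d.
    exists (2^-1 * (eb - ea + (`|a| ^+ 2 - `|b| ^+ 2))).
    have -> : (fun n => dot (a - b) (u n)) = (fun n => 2^-1 *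
        (`|u n - b| ^+ 2 - `|u n - a| ^+ 2 + (`|a| ^+ 2 - `|b| ^+ 2))).
      by apply/funext => n; rewrite !sqr_normB dotBl !(dotC (u n)); field.
    apply: cvgM; first exact: cvg_cst.
    by apply: cvgD; [exact: cvgB|exact: cvg_cst].
  have da : dot (a - b) a = d.
    by apply: cvg_unique (ua (a - b)) (cvg_trans _ dP) => //; exact: cvg_app.
  have db : dot (a - b) b = d.
    by apply: cvg_unique (ub (a - b)) (cvg_trans _ dP) => //; exact: cvg_app.
  apply/eqP; rewrite -subr_eq0; apply/eqP/dot_eq0.
  by rewrite dotBr da db subrr.
have [U0 [UU0 oU0]] := ultraFilterLemma (eventually_filter).
have [a ua] := bounded_ultra_weak_cvg U0 C u cV UU0 uC.
exists a; first exact: wS ua.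
move=> l lc.
have [D lD] : exists D, forall y, `|l y| <= D * `|y|.
  have /linear_boundedP Lb := continuous_linear_bounded 0 (lc 0).
  by near +oo_R => D; exists D; near: D.
have [|w lw] := @riesz_representation R V l D cV _ lD.
  by move=> ? ? ?; rewrite linearP.
rewrite lw; under eq_fun do rewrite lw dotC; rewrite dotC.
apply: cvg_ultra => U UU oU.
have [b ub] := bounded_ultra_weak_cvg U C u cV UU uC.
by rewrite (uniq _ _ _ _ UU0 UU oU0 oU ua ub); exact: ub.
Unshelve. all: by end_near. Qed.

End weak_convergence.

(** * The Landweber iteration under the cone condition *)

(** dF u stands for the derivative of F at u, known here through its bound M and the
    cone condition. *)
Section landweber.
Context {R : realType} {V W : preHilbertType R} (cV : rapidly_complete V)
  (F : V -> W) (dF : V -> {linear V -> W}) (phi : W) (c : V) (r M mu : R).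
Context (r0 : 0 <= r) (M0 : 0 < M) (mu0 : 0 < mu).
Context (FM : forall u, `|u - c| <= r -> forall v, `|dF u v| <= M * `|v|).
Context (cone : forall u v, `|u - c| <= r -> `|v - c| <= r ->
  (M ^+ 2 + mu) * `|F u - F v| ^+ 2 <= 2 * dot (F u - F v) (dF u (u - v))).

(** The cone condition dominates the cross term of the expanded square and the
    bound M dominates the quadratic one; mu is what is left. *)
Lemma landweber_step (u s : V) : `|u - c| <= r -> `|s - c| <= r -> F s = phi ->
  `|u - adjoint (dF u) (F u - phi) - s| ^+ 2 + mu * `|F u - phi| ^+ 2 <=
  `|u - s| ^+ 2.
Proof.
move=> ur sr Fs; have := cone _ _ ur sr; rewrite Fs => h.
rewrite addrAC [X in X + _ <= _]sqr_normB -(adjointP (dF u) M cV (FM _ ur)) dotC.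
have h2 : `|adjoint (dF u) (F u - phi)| ^+ 2 <= M ^+ 2 * `|F u - phi| ^+ 2.
  rewrite -exprMn ler_pXn2r ?nnegrE ?mulr_ge0 ?(ltW M0)//.
  exact: adjoint_le (ltW M0) (FM _ ur).
lra.
Qed.

(** The cone condition is applied with a in the first place and u_n in the second,
    so that the linear map in it is the fixed one at a and can be moved, as an
    adjoint, onto the other side of weak convergence. *)
Lemma weak_limit_solution (U : set_system nat) (u : nat -> V) (a : V) :
  ProperFilter U -> (forall n, `|u n - c| <= r) ->
  F (u n) @[n --> U] --> phi ->
  (forall z, dot z (u n) @[n --> U] --> (dot z a : R)) -> F a = phi.
Proof.
move=> PU ur Fu ua; have ar := weak_limit_ball U a c r u PU r0 ur ua.
(* F a - F (u n) is split as (F a - phi) + (phi - F (u n)): against the first,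
   fixed, part the adjoint turns weak convergence of u into convergence to 0; the
   second part is small and dF a (a - u n) bounded. *)
have d0 : dot (F a - F (u n)) (dF a (a - u n)) @[n --> U] --> (0 : R).
  have -> : (fun n => dot (F a - F (u n)) (dF a (a - u n))) =
    (fun n => (dot (adjoint (dF a) (F a - phi)) a -
        dot (adjoint (dF a) (F a - phi)) (u n)) +
      dot (phi - F (u n)) (dF a (a - u n))).
    apply/funext => n; rewrite -dotBr [dot (adjoint _ _) _]dotC.
    rewrite -(adjointP (dF a) M cV (FM _ ar)) [X in _ = X + _]dotC -dotDl.
    by rewrite addrA subrK.
  rewrite -[X in _ --> X]addr0; apply: cvgD.
    rewrite -(subrr (dot (adjoint (dF a) (F a - phi)) a)).
    by apply: cvgB (ua _); exact: cvg_cst.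
  apply/norm_cvg0P.
  have h : `|phi - F (u n)| * (M * (r + r)) @[n --> U] --> (0 : R).
    rewrite -(mul0r (M * (r + r))) -(@normr0 _ W) -(subrr phi).
    apply: cvgM (cvg_cst _); apply: cvg_norm.
    by apply: cvgB Fu; exact: cvg_cst.
  apply: (squeeze_cvgr _ (cvg_cst 0) h); apply: (@filterE _ U) => n.
  rewrite normr_ge0/= (le_trans (cauchy_schwarz _ _))// ler_wpM2l//.
  rewrite (le_trans (FM _ ar _))// ler_wpM2l ?(ltW M0)//.
  rewrite -(subrKA c) (le_trans (ler_normD _ _))// lerD//.
  by rewrite distrC.
have F2 : (M ^+ 2 + mu) * `|F a - F (u n)| ^+ 2 @[n --> U] -->
    (M ^+ 2 + mu) * `|F a - phi| ^+ 2.
  apply: cvgM; first exact: cvg_cst.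
  rewrite expr2; under eq_fun do rewrite expr2.
  have h : `|F a - F (u n)| @[n --> U] --> `|F a - phi|.
    by apply: cvg_norm; apply: cvgB Fu; exact: cvg_cst.
  exact: cvgM.
have /(ler_cvg_to F2)/(_ _)-h :
    2 * dot (F a - F (u n)) (dF a (a - u n)) @[n --> U] --> 2 * (0 : R).
  by apply: cvgM d0; exact: cvg_cst.
have {}h : (M ^+ 2 + mu) * `|F a - phi| ^+ 2 <= 2 * 0.
  by apply: h; apply: (@filterE _ U) => n; exact: cone.
rewrite mulr0 pmulr_rle0 in h; last by rewrite addr_gt0// exprn_gt0.
apply/eqP; rewrite -subr_eq0 -normr_eq0 -sqrf_eq0 eq_le h; exact: sqr_ge0.
Qed.

Context (us : V) (u : nat -> V) (usr : `|us - c| <= r / 2) (Fus : F us = phi)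
  (u0r : `|u 0%N - us| <= r / 2)
  (ulw : forall k, u k.+1 = u k - adjoint (dF (u k)) (F (u k) - phi)).

Let half : r / 2 <= r. Proof. by move: r0; lra. Qed.

(** The induction runs on the distance to the solution us, which decreases; the
    ball about c only enters through the radius r / 2 + r / 2. *)
Lemma landweber_stays k : `|u k - us| <= r / 2 /\ `|u k - c| <= r.
Proof.
suff h : `|u k - us| <= r / 2.
  split=> //; rewrite -(subrKA us) (le_trans (ler_normD _ _))//.
  by rewrite [leRHS]splitr lerD.
elim: k => [//|k ih].
have ukr : `|u k - c| <= r.
  rewrite -(subrKA us) (le_trans (ler_normD _ _))//.
  by rewrite [leRHS]splitr lerD.
apply: le_trans ih; rewrite -(@ler_pXn2r _ 2)// ?nnegrE//.
have := landweber_step _ _ ukr (le_trans usr half) Fus; rewrite -ulw.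
apply: le_trans; rewrite lerDl mulr_ge0 ?sqr_ge0 ?ltW//.
Qed.

Lemma landweber_decrease s k : `|s - c| <= r -> F s = phi ->
  `|u k.+1 - s| ^+ 2 + mu * `|F (u k) - phi| ^+ 2 <= `|u k - s| ^+ 2.
Proof.
move=> sr Fs; rewrite ulw; apply: landweber_step => //.
by case: (landweber_stays k).
Qed.

Lemma landweber_fejer s k : `|s - c| <= r -> F s = phi ->
  `|u k.+1 - s| <= `|u k - s|.
Proof.
move=> sr Fs; rewrite -(@ler_pXn2r _ 2)// ?nnegrE//.
apply: le_trans (landweber_decrease s k sr Fs).
by rewrite lerDl mulr_ge0 ?sqr_ge0 ?ltW.
Qed.

Lemma landweber_residual_sum n :
  mu * \sum_(k < n) `|F (u k) - phi| ^+ 2 <= (r / 2) ^+ 2.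
Proof.
have usr' := le_trans usr half.
suff h : mu * \sum_(k < n) `|F (u k) - phi| ^+ 2 + `|u n - us| ^+ 2 <=
    `|u 0%N - us| ^+ 2.
  apply: le_trans (_ : `|u 0%N - us| ^+ 2 <= _).
    by apply: le_trans h; rewrite lerDl sqr_ge0.
  by rewrite ler_pXn2r ?nnegrE ?divr_ge0.
elim: n => [|n ih]; first by rewrite big_ord0 mulr0 add0r.
apply: le_trans ih; rewrite big_ord_recr/= mulrDr -addrA lerD2l addrC.
exact: landweber_decrease.
Qed.

Lemma landweber_residual_cvg : F (u n) @[n --> \oo] --> phi.
Proof.
have usr' := le_trans usr half.
apply/subr_cvg0/norm_cvg0P.
have [e ee] : exists e : R, `|u n - us| ^+ 2 @[n --> \oo] --> e.
  apply/cvg_ex; apply: nonincreasing_is_cvgn.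
    apply/nonincreasing_seqP => n.
    by rewrite ler_pXn2r ?nnegrE ?landweber_fejer.
  by exists 0 => _ [n _ <-]; exact: sqr_ge0.
(* mu times the squared residual is at most a step of the convergent sequence of
   squared distances. *)
have h : mu^-1 * (`|u n - us| ^+ 2 - `|u n.+1 - us| ^+ 2) @[n --> \oo] -->
    (0 : R).
  rewrite -(mulr0 mu^-1) -(subrr e); apply: cvgM; first exact: cvg_cst.
  by apply: cvgB; [exact: ee|rewrite (cvg_shiftS (fun n => `|u n - us| ^+ 2))].
have h2 : `|F (u n) - phi| ^+ 2 @[n --> \oo] --> (0 : R).
  apply: (squeeze_cvgr _ (cvg_cst 0) h); near=> n; rewrite sqr_ge0/=.
  by rewrite ler_pdivlMl//; have := landweber_decrease us n usr' Fus; lra.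
have -> : (fun n => `|F (u n) - phi|) =
    (fun n => Num.sqrt (`|F (u n) - phi| ^+ 2)).
  by apply/funext => n; rewrite sqrtr_sqr normr_id.
rewrite -(@sqrtr0 R).
exact: (@cvg_comp _ _ _ _ _ _ _ _ h2 (@sqrt_continuous R 0)).
Unshelve. all: by end_near. Qed.

Lemma landweber_weak_cvg : exists2 a, F a = phi & weakly_cvg u a.
Proof.
have [|s [sr Fs] n|U a UU oU ua|a [_ Fa] ua] := fejer_weak_cvg
  [set s | `|s - c| <= r /\ F s = phi] (r + `|c|) u cV.
- move=> n; rewrite -[u n](subrK c) (le_trans (ler_normD _ _))// lerD2r.
  by case: (landweber_stays n).
- exact: landweber_fejer.
- split; first by apply: weak_limit_ball ua => // n; case: (landweber_stays n).
  apply: weak_limit_solution ua; first by move=> n; case: (landweber_stays n).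
  by apply: cvg_trans landweber_residual_cvg; exact: cvg_app.
- by exists a.
Qed.

(** Cauchy-Schwarz bounds the inner product of the cone condition by
    |F v - F w| M |v - w|; a factor |F v - F w| cancels. *)
Lemma lipschitz_of_cone v w : `|v - c| <= r -> `|w - c| <= r ->
  `|F v - F w| <= 2 * M / (M ^+ 2 + mu) * `|v - w|.
Proof.
move=> vr wr.
have [->|n0] := eqVneq `|F v - F w| 0.
  by rewrite mulr_ge0// divr_ge0 ?mulr_ge0// ?addr_ge0 ?sqr_ge0 ?ltW.
have np : 0 < `|F v - F w| by rewrite lt0r n0/=.
have p0 : 0 < M ^+ 2 + mu by rewrite addr_gt0// exprn_gt0.
rewrite mulrAC ler_pdivlMr// -(ler_pM2l np).
have := cone _ _ vr wr.
have := le_trans (ler_norm _) (cauchy_schwarz (F v - F w) (dF v (v - w))).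
have : `|F v - F w| * `|dF v (v - w)| <= `|F v - F w| * (M * `|v - w|).
  by rewrite ler_wpM2l// FM.
lra.
Qed.

Context (C alpha : R) (C0 : 0 < C) (alpha1 : 1 <= alpha).
Context (coercive : forall v, `|v - c| <= r ->
  `|v - us| `^ alpha <= C * `|F v - F us|).

(** |u_k - us| decreases in k, so k |u_k - us|^(2 alpha) is at most the sum of
    |u_j - us|^(2 alpha) over j < k, which coercivity bounds by C^2 times the sum
    of the squared residuals. *)
Lemma landweber_rate : exists2 K : R, 0 < K &
  forall k, (0 < k)%N -> `|u k - us| <= K * (1 / k%:R `^ (1 / (2 * alpha))).
Proof.
have usr' := le_trans usr half.
have a0 : 0 < alpha by apply: lt_le_trans alpha1.
(* The summand 1 only makes B positive. *)
pose B := 1 + C ^+ 2 * ((r / 2) ^+ 2 / mu).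
have B0 : 0 < B.
  by rewrite ltr_pwDl// mulr_ge0 ?divr_ge0 ?sqr_ge0// ltW.
exists (B `^ (1 / (2 * alpha))); first by rewrite powR_gt0.
move=> k k0; set x := `|u k - us|.
have x0 : 0 <= x by rewrite normr_ge0.
have mono j : (j <= k)%N -> x <= `|u j - us|.
  move=> jk; have : nonincreasing_seq (fun n => `|u n - us|).
    by apply/nonincreasing_seqP => n; exact: landweber_fejer.
  by apply.
have kR : 0 < k%:R :> R by rewrite ltr0n.
have h : k%:R * x `^ (2 * alpha) <= B.
  have -> : x `^ (2 * alpha) = (x `^ alpha) ^+ 2.
    by rewrite mulrC powRrM -powR_mulrn ?powR_ge0.
  have hs := landweber_residual_sum k.
  have : k%:R * (x `^ alpha) ^+ 2 <=
      C ^+ 2 * \sum_(j < k) `|F (u j) - phi| ^+ 2.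
    rewrite mulr_natl -[k in leLHS]card_ord -sumr_const mulr_sumr.
    apply: ler_sum => j _.
    rewrite -exprMn ler_pXn2r ?nnegrE ?powR_ge0 ?mulr_ge0 ?(ltW C0)// -Fus.
    apply: le_trans (coercive _ _); last by case: (landweber_stays j).
    by apply: ge0_ler_powR; rewrite ?nnegrE ?(ltW a0)// mono// ltnW.
  move/le_trans; apply; rewrite /B ler_wpDl// ler_wpM2l ?sqr_ge0//.
  by rewrite ler_pdivlMr// mulrC.
have -> : x = (x `^ (2 * alpha)) `^ (1 / (2 * alpha)).
  rewrite -powRrM mulrC div1r mulVf ?powRr1//.
  by rewrite mulf_neq0 ?gt_eqF.
have -> : 1 / k%:R `^ (1 / (2 * alpha)) = (k%:R^-1) `^ (1 / (2 * alpha)) :> R.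
  by rewrite [LHS]div1r -powRN -(powR_inv1 (ltW kR)) -powRrM mulN1r.
rewrite -powRM ?invr_ge0 ?(ltW B0)//.
apply: ge0_ler_powR; rewrite ?nnegrE ?powR_ge0//.
- by rewrite div1r invr_ge0 mulr_ge0 ?(ltW a0).
- by rewrite mulr_ge0 ?invr_ge0 ?(ltW B0).
- by rewrite ler_pdivlMr// mulrC.
Qed.

End landweber.

(** * Sequences with summable steps *)

Lemma cvg_half_pow {R : realType} : cvgn (series (fun n => 2^-1 ^+ n : R)).
Proof.
have := @is_cvg_geometric_series R 1 2^-1.
rewrite (_ : geometric 1 _ = (fun n => 2^-1 ^+ n)); last first.
  by apply/funext => n /=; rewrite mul1r.
by apply; rewrite ger0_norm// invf_lt1//; lra.
Qed.

Lemma rapid_dist {R : realType} {V : normedModType R} (u : nat -> V) n m :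
  (forall n, `|u n.+1 - u n| <= 2^-1 ^+ n) ->
  `|u (n + m)%N - u n| <= 2 * 2^-1 ^+ n.
Proof.
(* The sharper bound, with the rest of the geometric series subtracted, is
   inductive. *)
move=> h; suff : `|u (n + m)%N - u n| <= 2 * 2^-1 ^+ n - 2 * 2^-1 ^+ (n + m)%N.
  by move/le_trans; apply; rewrite gerBl mulr_ge0// exprn_ge0.
elim: m => [|m ih]; first by rewrite addn0 !subrr normr0.
rewrite addnS -(subrKA (u (n + m)%N)) (le_trans (ler_normD _ _))//.
have := h (n + m)%N; rewrite exprS; set a := _ ^+ (n + m) in ih *; move: ih.
lra.
Qed.

Lemma summable_diff_cvg {R : realType} {E : hilbertType R} (u : nat -> E) :
  cvgn (series (fun n => `|u n.+1 - u n|)) ->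
  exists l : E, u n @[n --> \oo] --> l.
Proof.
move=> h; have /cvg_ex[l hl] := @normed_cvg R E (telescope u) h.
exists (u 0%N + l); rewrite (eq_fun (eq_sum_telescope u)).
by apply: cvgD => //; exact: cvg_cst.
Qed.

Lemma hilbert_rapidly_complete {R : realType} (E : hilbertType R) :
  rapidly_complete E.
Proof.
move=> u uC; apply: summable_diff_cvg.
by apply: series_le_cvg uC cvg_half_pow => n //; exact: exprn_ge0.
Qed.

(** * Almost everywhere limits of strongly measurable functions *)

Section measure_lemmas.
Context d (T : measurableType d) (R : realType) (mu : {measure set T -> \bar R}).
Context (D : set T) (mD : measurable D).

Lemma ae_fatou_bound (h : nat -> T -> R) (k : T -> R) (c : R) :
  (forall n, measurable_fun D (h n)) ->
  measurable_fun D k ->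
  (forall n t, 0 <= h n t) -> (forall t, 0 <= k t) ->
  (\forall t \ae mu, D t -> h n t @[n --> \oo] --> k t) ->
  (forall n, (\int[mu]_(t in D) (h n t)%:E <= c%:E)%E) ->
  (\int[mu]_(t in D) (k t)%:E <= c%:E)%E.
Proof.
move=> mh mk h0 k0 [N [mN N0 hkN]] hc.
have mDN : measurable (D `\` N) by exact: measurableD.
have DND : D `\` N `<=` D by exact: subDsetl.
have mh' n : measurable_fun (D `\` N) (EFin \o h n).
  by apply/measurable_EFinP; apply: measurable_funS (mh n).
rewrite (@ge0_negligible_integral _ _ _ mu D N)//; last 2 first.
- exact/measurable_EFinP.
- by move=> t _; rewrite lee_fin.
have -> : (\int[mu]_(t in D `\` N) (k t)%:E =
    \int[mu]_(t in D `\` N) limn_einf (fun n => (h n t)%:E))%E.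
  apply: eq_integral => t /set_mem[Dt Nt].
  have cv : (h n t)%:E @[n --> \oo] --> (k t)%:E.
    apply: cvg_EFin; first exact: nearW.
    by apply: contrapT => nc; apply: Nt; apply: hkN => /(_ Dt).
  by rewrite is_cvg_limn_einfE ?(cvg_lim _ cv)//; apply/cvg_ex; eexists; exact: cv.
apply: le_trans (fatou mu mDN mh' _) _; first by move=> n t _; rewrite lee_fin.
rewrite limn_einf_lim; apply: lime_le; first exact: is_cvg_einfs.
apply: nearW => n; apply: (@le_trans _ _ (\int[mu]_(t in D `\` N) (h n t)%:E)%E).
  by apply: ereal_inf_lbound; exists n => //=.
apply: le_trans (hc n); apply: ge0_subset_integral => //.
  exact/measurable_EFinP.
by move=> t _; rewrite lee_fin.
Qed.

(** Summable integrals: the sum of the h_n has finite integral, by monotone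
    convergence, hence is finite almost everywhere. *)
Lemma ae_summable (h : nat -> T -> R) (c : nat -> R) :
  (forall n, measurable_fun D (h n)) ->
  (forall n t, 0 <= h n t) -> (forall n, 0 <= c n) ->
  (forall n, (\int[mu]_(t in D) (h n t)%:E <= (c n)%:E)%E) ->
  cvgn (series c) ->
  \forall t \ae mu, D t -> cvgn (series (fun n => h n t)).
Proof.
move=> mh h0 c0 hc sc.
have mh' n : measurable_fun D (EFin \o h n).
  exact/measurable_EFinP.
have s0 t : (0 <= \sum_(n <oo) (h n t)%:E)%E.
  by apply: nneseries_ge0 => n _ _; rewrite lee_fin.
have : mu.-integrable D (fun t => \sum_(n <oo) (h n t)%:E)%E.
  apply/integrableP; split.
    apply: ge0_emeasurable_sum => //.
      by move=> n t _ _; rewrite lee_fin.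
    by move=> n _; exact: mh'.
  under eq_integral do rewrite gee0_abs//.
  rewrite integral_nneseries//; last by move=> n t _; rewrite lee_fin.
  apply: (@le_lt_trans _ _ (\sum_(n <oo) (c n)%:E)%E).
    apply: lee_nneseries => // n _ _.
    by apply: integral_ge0 => t _; rewrite lee_fin.
  rewrite (_ : (\sum_(n <oo) (c n)%:E)%E = (limn (series c))%:E) ?ltry//.
  rewrite -EFin_lim//; congr (limn _); apply/funext => n /=.
  by rewrite /series/= sumEFin.
move/(integrable_ae mD); apply: filterS => t /[apply] ft.
apply: nondecreasing_is_cvgn.
  by apply/nondecreasing_seqP => n; rewrite /series/= big_nat_recr//= lerDl.
exists (fine (\sum_(n <oo) (h n t)%:E)%E) => _ [n _ <-].
rewrite -lee_fin fineK// /series/= -sumEFin.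
by apply: nneseries_lim_ge => i _ _; rewrite lee_fin.
Qed.

End measure_lemmas.

Lemma strongly_measurable_norm {R : realType} {E : normedModType R} (D : set R)
    (phi : R -> R) (f : R -> E) :
  measurable (D : set (measurableTypeR R)) -> continuous phi ->
  strongly_measurable D f ->
  measurable_fun (D : set (measurableTypeR R)) (fun t => phi `|f t|).
Proof.
move=> mD cphi mf; apply: strongly_measurableR => //.
have hc : continuous (fun p : E * E => phi `|p.1| : R^o).
  move=> p; have h : `|q.1| @[q --> p] --> `|p.1|.
    by apply: cvg_norm; exact: cvg_fst.
  exact: (@cvg_comp _ _ _ _ _ _ _ _ h (cphi _)).
exact: (@strongly_measurable_comp2 _ _ _ _ (fun x _ => phi `|x| : R^o)
  D f f hc mf mf).
Qed.

Lemma strongly_measurableB {R : realType} {E : normedModType R} (D : set R)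
    (f g : R -> E) :
  strongly_measurable D f -> strongly_measurable D g ->
  strongly_measurable D (fun t => f t - g t).
Proof.
apply: (@strongly_measurable_comp2 _ _ _ _ (fun x y => x - y)).
by move=> p; apply: cvgB; [exact: cvg_fst|exact: cvg_snd].
Qed.

Section strongly_measurable_limits.
Context {R : realType} (T : R) {E : normedModType R}.
Let D : set R := `]0, T[.
Notation mu := (@lebesgue_measure R).

Let mD : measurable (D : set (measurableTypeR R)).
Proof. exact: measurable_itv. Qed.

Lemma simple_fun_indic (A : set R) : measurable (A : set (measurableTypeR R)) ->
  simple_fun (\1_A : R -> R^o).
Proof.
move=> mA; split.
  by apply: (@sub_finite_set _ _ [set 0; 1]) => // _ [t _ <-];
    rewrite indicE; case: (_ \in _); [right|left].
move=> y; rewrite (_ : _ @^-1` _ =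
    (if (y == 1) then A else if y == 0 then ~` A else set0)).
  by case: ifP => // _; case: ifP => // _; exact: measurableC.
apply/seteqP; split => t /=; rewrite indicE.
  by case: (boolP (t \in A)) => [/set_mem At <-|/negP At <-];
    rewrite ?eqxx// eq_sym oner_eq0 => /mem_set.
case: eqP => [-> /mem_set ->//|_]; case: eqP => // -> At.
by rewrite memNset.
Qed.

(** The integral of min(1, |f - s|) metrises convergence in measure.  Its integrand
    is dominated by 1, which is integrable on a bounded interval, so the simple
    functions converging to f pointwise converge in this sense as well. *)
Lemma simple_approx (f : R -> E) (e : R) : strongly_measurable D f -> 0 < e ->
  exists2 s : R -> E, simple_fun s &
    (\int[mu]_(t in D) (Num.min 1 `|f t - s t|)%:E <= e%:E)%E.
Proof.
move=> mf e0; have [s ss sf] := mf.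
have mh n : measurable_fun (D : set (measurableTypeR R))
    (EFin \o (fun t => Num.min 1 `|f t - s n t|)).
  apply/measurable_EFinP; apply: strongly_measurable_norm => //.
    by move=> x; apply: continuous_min; [exact: cvg_cst|exact: cvg_id].
  apply: strongly_measurableB => //.
  by exists (fun=> s n) => // t _; exact: cvg_cst.
have cv0 : \forall t \ae mu, D t ->
    (Num.min 1 `|f t - s n t|)%:E @[n --> \oo] --> 0%E.
  apply: aeW => t Dt; apply: cvg_EFin; first exact: nearW.
  have h : `|f t - s n t| @[n --> \oo] --> (0 : R).
    rewrite -(@normr0 _ E) -(subrr (f t)); apply: cvg_norm.
    by apply: cvgB (sf t Dt); exact: cvg_cst.
  apply: (squeeze_cvgr _ (cvg_cst 0) h); apply: nearW => n.
  by rewrite /= le_min ler01 normr_ge0 ge_min lexx orbT.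
have i1 : mu.-integrable D (cst 1%E).
  apply/integrableP; split; first exact: measurable_cst.
  under eq_integral do rewrite /= normr1.
  rewrite integral_cst// mul1e.
  suff : (lebesgue_measure D < +oo)%E by [].
  by rewrite /D lebesgue_measure_itv/=; case: ifP => _; rewrite ltry.
have le1 : \forall t \ae mu, forall n, D t ->
    (`|(Num.min 1 `|f t - s n t|)%:E| <= 1)%E.
  apply: aeW => t n Dt.
  by rewrite gee0_abs lee_fin ?ge_min ?lexx// le_min ler01 normr_ge0.
have [_ _ h] := dominated_convergence mD mh (measurable_cst 0%E) cv0 i1 le1.
rewrite integral0 in h.
have [n hn] : exists n,
    (\int[mu]_(t in D) (Num.min 1 `|f t - s n t|)%:E < e%:E)%E.
  have eB : nbhs (0%:E : \bar R) [set y | (y < e%:E)%E].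
    exact: (open_nbhs_nbhs (conj (@open_ereal_lt_ereal R e%:E) _)).
  have [N _ hN] := h _ eB.
  by exists N; exact: (hN N (leqnn N)).
by exists (s n) => //; exact: ltW.
Qed.

(** Pick a simple s_n within 2^-n of u_n in the sense of [simple_approx].  These
    errors are summable, so almost everywhere |u_n - s_n| tends to 0 and s_n tends
    to f; it remains to put s_n and f to 0 on a null Borel set. *)
Lemma strongly_measurable_ae_lim (u : nat -> R -> E) (f : R -> E) :
  (forall n, strongly_measurable D (u n)) ->
  (\forall t \ae mu, D t -> u n t @[n --> \oo] --> f t) ->
  exists2 g : R -> E, strongly_measurable D g & f = g %[ae mu in D].
Proof.
move=> mu_ uf.
have e0 n : 0 < 2^-1 ^+ n :> R by rewrite exprn_gt0.
have /(_ _)/cid2-/all_sig2[s ss su] n := simple_approx (u n) _ (mu_ n) (e0 n).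
have su0 : \forall t \ae mu, D t ->
    cvgn (series (fun n => Num.min 1 `|u n t - s n t|)).
  apply: (@ae_summable _ _ R mu D mD _ (fun n => 2^-1 ^+ n)).
  - move=> n; apply: strongly_measurable_norm => //.
      by move=> x; apply: continuous_min; [exact: cvg_cst|exact: cvg_id].
    apply: strongly_measurableB => //.
    by exists (fun=> s n) => // t _; exact: cvg_cst.
  - by move=> n t; rewrite le_min ler01 normr_ge0.
  - by move=> n; exact: ltW.
  - exact: su.
  - exact: cvg_half_pow.
have sf : \forall t \ae mu, D t -> s n t @[n --> \oo] --> f t.
  apply: ae_imp2 uf su0 => t uft sut Dt.
  have ut := uft Dt; have st := cvg_series_cvg_0 (sut Dt).
  have st0 : `|u n t - s n t| @[n --> \oo] --> (0 : R).
    have lt1 := cvgr_lt 0 st 1 ltr01.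
    apply: cvg_trans st; apply: near_eq_cvg.
    apply: filterS (lt1 _) => n.
    by rewrite gt_min ltxx/= => /ltW /min_idPr.
  have -> : s^~ t = (fun n => u n t - (u n t - s n t)).
    by apply/funext => n; rewrite subKr.
  rewrite -[f t]subr0; apply: cvgB => //.
  exact/norm_cvg0P.
have [N [mN N0 sfN]] := sf.
exists (fun t => \1_(~` N) t *: f t); last first.
  exists N; split => // t /= h; apply: contrapT => nN; apply: h => Dt.
  by rewrite indicE mem_set// scale1r.
exists (fun n t => \1_(~` N) t *: s n t) => [n|t Dt].
  apply: (@simple_fun_comp2 _ _ _ _ (fun (a : R^o) (x : E) => a *: x)) => //.
  by apply: simple_fun_indic; exact: measurableC.
have [Nt|nN] := pselect (N t).
  have -> : \1_(~` N) t = 0 :> R by rewrite indicE memNset.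
  by under eq_fun do rewrite scale0r; rewrite scale0r; exact: cvg_cst.
apply: cvgZl_tmp; apply: contrapT => h; apply: nN; apply: sfN => /(_ Dt).
exact: h.
Unshelve. all: by end_near. Qed.

End strongly_measurable_limits.

(** * Completeness of the Bochner space *)

Section L2_complete.
Context {R : realType} (T : R) {E : hilbertType R}.
Let D : set R := `]0, T[.
Notation mu := (@lebesgue_measure R).

Let mD : measurable (D : set (measurableTypeR R)).
Proof. exact: measurable_itv. Qed.

Let sqr_continuous : continuous (fun x : R => x ^+ 2).
Proof. exact: exprn_continuous. Qed.

Lemma integral_sqr_norm_ae (x : L2 T E) (f : R -> E) : strongly_measurable D f ->
  L2repr x = f %[ae mu in D] ->
  (\int[mu]_(t in D) (`|f t| ^+ 2)%:E = (`|x| ^+ 2)%:E)%E.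
Proof.
move=> mf xf; have sx := L2repr_sq_integrable x; have [mx _] := sx.
rewrite -dot_norm L2dotE /Rintegral fineK; last first.
  exact: integrable_fin_num (dot_integrable sx sx).
apply: ge0_ae_eq_integral => //.
- apply/measurable_EFinP.
  exact: (@strongly_measurable_norm _ _ _ (fun x => x ^+ 2)).
- by apply: measurable_int; exact: dot_integrable.
- by move=> t _; rewrite lee_fin dot_ge0.
- by apply: ae_imp xf => t xf Dt; rewrite -dot_norm xf.
Qed.

Lemma integral_sqr_dist (x y : L2 T E) (f g : R -> E) :
  strongly_measurable D f -> strongly_measurable D g ->
  L2repr x = f %[ae mu in D] -> L2repr y = g %[ae mu in D] ->
  (\int[mu]_(t in D) (`|f t - g t| ^+ 2)%:E = (`|x - y| ^+ 2)%:E)%E.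
Proof.
move=> mf mg xf yg; apply: integral_sqr_norm_ae; first exact: strongly_measurableB.
have yN := L2reprZ (-1) y.
rewrite -scaleN1r.
apply: ae_imp2 (L2reprD x (-1 *: y)) (_ : \forall t \ae mu, D t ->
  L2repr x t = f t /\ L2repr (-1 *: y) t = - g t).
  by move=> t h xy Dt; have [xf' yg'] := xy Dt; rewrite (h Dt) xf' yg'.
apply: ae_imp2 xf (_ : \forall t \ae mu, D t -> L2repr (-1 *: y) t = - g t).
  by move=> t xf yg' Dt; rewrite (xf Dt) (yg' Dt).
by apply: ae_imp2 yg yN => t yg yN Dt; rewrite (yN Dt) (yg Dt) scaleN1r.
Qed.

(** Riesz-Fischer.  The steps of x have squared norm at most 4^-n, so the weights
    2^n keep the integrals of the w_n summable; where the w_n are summable, so are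
    the norms of the steps, and the representatives converge in E.  Fatou bounds
    the distance of x_n to this limit. *)
Lemma L2_rapidly_complete : rapidly_complete (L2 T E).
Proof.
move=> x xC.
have mx n : strongly_measurable D (L2repr (x n)).
  by case: (L2repr_sq_integrable (x n)).
have ae_refl n : L2repr (x n) = L2repr (x n) %[ae mu in D] by exact: aeW.
pose w n t := 2 ^+ n * `|L2repr (x n.+1) t - L2repr (x n) t| ^+ 2.
have cw : \forall t \ae mu, D t -> cvgn (series (fun n => w n t)).
  apply: (@ae_summable _ _ R mu D mD w (fun n => 2^-1 ^+ n)).
  - move=> n; apply: measurable_funM => //.
    apply: (@strongly_measurable_norm _ _ _ (fun x => x ^+ 2)) => //.
    exact: strongly_measurableB.
  - by move=> n t; rewrite mulr_ge0 ?exprn_ge0.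
  - by move=> n; rewrite exprn_ge0.
  - move=> n; under eq_integral do rewrite EFinM.
    rewrite ge0_integralZl//; first last.
    + apply/measurable_EFinP.
      apply: (@strongly_measurable_norm _ _ _ (fun x => x ^+ 2)) => //.
      exact: strongly_measurableB.
    rewrite (integral_sqr_dist _ _ _ _ (mx _) (mx _) (ae_refl _) (ae_refl _)).
    rewrite -EFinM lee_fin.
    have h : `|x n.+1 - x n| ^+ 2 <= (2^-1 ^+ n) ^+ 2.
      by rewrite ler_pXn2r ?nnegrE ?exprn_ge0.
    apply: le_trans (ler_wpM2l _ h) _; first by rewrite exprn_ge0.
    by rewrite expr2 mulrA -exprMn divff// expr1n mul1r.
  - exact: cvg_half_pow.
have cx : \forall t \ae mu, D t ->
    exists l : E, L2repr (x n) t @[n --> \oo] --> l.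
  apply: ae_imp cw => t cw /cw{}cw; apply: summable_diff_cvg.
  (* 2 |a| <= 2^n |a|^2 + 2^-n for the step a of index n at t. *)
  have cs : cvgn (series (fun n => w n t + 2^-1 ^+ n)).
    have -> : series (fun n => w n t + 2^-1 ^+ n) =
        series (w ^~ t) + series (fun n => 2^-1 ^+ n) by rewrite seriesD.
    by apply: is_cvgD => //; exact: cvg_half_pow.
  apply: series_le_cvg cs => //.
  - by move=> n; rewrite addr_ge0 ?exprn_ge0// mulr_ge0 ?exprn_ge0.
  - move=> n; rewrite /w; set a := `|_|.
    have p0 : 0 < 2 ^+ n :> R by rewrite exprn_gt0.
    rewrite exprVn; set p := 2 ^+ n in p0 *.
    rewrite -(ler_pM2l p0) mulrDr mulfV ?gt_eqF//.
    have := sqr_ge0 (p * a - 1); have := sqr_ge0 (p * a); nra.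
pose f t : E := xget 0 [set l | L2repr (x n) t @[n --> \oo] --> l].
have xf : \forall t \ae mu, D t -> L2repr (x n) t @[n --> \oo] --> f t.
  by apply: ae_imp cx => t ct /ct ex; exact: (xgetPex 0 ex).
have [g mg fg] := strongly_measurable_ae_lim T _ f mx xf.
have xg : \forall t \ae mu, D t -> L2repr (x n) t @[n --> \oo] --> g t.
  by apply: ae_imp2 xf fg => t xf fg Dt; rewrite -(fg Dt); exact: xf.
have ig n : (\int[mu]_(t in D) (`|g t - L2repr (x n) t| ^+ 2)%:E <=
    ((2 * 2^-1 ^+ n) ^+ 2)%:E)%E.
  apply: (@ae_fatou_bound _ _ R mu D mD
    (fun m t => `|L2repr (x (n + m)%N) t - L2repr (x n) t| ^+ 2)).
  - move=> m; apply: (@strongly_measurable_norm _ _ _ (fun x => x ^+ 2)) => //.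
    exact: strongly_measurableB.
  - apply: (@strongly_measurable_norm _ _ _ (fun x => x ^+ 2)) => //.
    exact: strongly_measurableB.
  - by move=> m t; exact: sqr_ge0.
  - by move=> t; exact: sqr_ge0.
  - apply: ae_imp xg => t xg Dt.
    have h : `|L2repr (x (n + m)%N) t - L2repr (x n) t| @[m --> \oo] -->
        `|g t - L2repr (x n) t|.
      apply: cvg_norm; apply: cvgB; last exact: cvg_cst.
      by have := xg Dt; rewrite -(cvg_shiftn n); under eq_fun do rewrite addnC.
    exact: (@cvg_comp _ _ _ _ _ _ _ _ h (sqr_continuous _)).
  - move=> m.
    rewrite (integral_sqr_dist _ _ _ _ (mx _) (mx _) (ae_refl _) (ae_refl _)).
    rewrite lee_fin ler_pXn2r ?nnegrE ?mulr_ge0 ?exprn_ge0//.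
    exact: rapid_dist.
(* g is the sum of g - L2repr (x 0), square integrable by [ig], and of
   L2repr (x 0). *)
have sg : g \in @sq_integrable_pred R T E.
  have d0 : (fun t => g t - L2repr (x 0%N) t) \in @sq_integrable_pred R T E.
    apply/mem_set; split; first exact: strongly_measurableB.
    by apply: le_lt_trans (ig 0%N) _; rewrite ltry.
  have x0 : L2repr (x 0%N) \in @sq_integrable_pred R T E.
    by apply/mem_set; exact: L2repr_sq_integrable.
  have -> : g = (fun t => g t - L2repr (x 0%N) t) + L2repr (x 0%N).
    by apply/funext => t; rewrite fctE subrK.
  exact: rpredD.
pose y : L2 T E := (\pi_(L2 T E)%qT (MkL2fun sg)).
have yg : L2repr y = g %[ae mu in D] by exact: L2repr_pi.
exists y; apply/cvgrPdist_le => e e0.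
have c0 : 2 * 2^-1 ^+ n @[n --> \oo] --> (0 : R).
  rewrite -(mulr0 2); apply: cvgM; first exact: cvg_cst.
  by apply: cvg_expr; rewrite ger0_norm// invf_lt1//; lra.
have lte := cvgr_lt 0 c0 e e0.
apply: filterS (lte _) => n /ltW; apply: le_trans.
rewrite -(@ler_pXn2r _ 2) ?nnegrE ?mulr_ge0 ?exprn_ge0//.
by rewrite -lee_fin -(integral_sqr_dist _ _ _ _ mg (mx n) yg (ae_refl n)).
Qed.

End L2_complete.

(** * Completeness of the evolution space *)

Section evolution_complete.
Context {R : realType} (T : R).
Let D : set R := `]0, T[.
Notation mu := (@lebesgue_measure R).

Let mD : measurable (D : set (measurableTypeR R)).
Proof. exact: measurable_itv. Qed.

Import HBSimple.

Lemma sq_integrable_scale {E : hilbertType R} (phi : R -> R) (e : E) :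
  continuous phi -> sq_integrable T (fun t => phi t *: e).
Proof.
move=> phic; split.
  have mphi : measurable_fun (D : set (measurableTypeR R)) (EFin \o phi).
    apply/measurable_EFinP; apply: measurable_funTS.
    exact: continuous_measurable_fun.
  have [s sphi] := approximation_sfun mD mphi.
  exists (fun n t => s n t *: e).
    move=> n; apply: (@simple_fun_comp2 _ _ _ _ (fun (a : R^o) (_ : E) => a *: e)
      (s n) (fun=> e)); last exact: simple_fun_cst.
    split; first exact: (fimfunP (s n)).
    by move=> y; exact: (measurable_funPTI (s n) (measurable_set1 y)).
  move=> t Dt; apply: cvgZr_tmp.
  by have := sphi t Dt; move/fine_cvgP => [].
have pp : mu.-integrable D (EFin \o (fun t => phi t ^+ 2)).
  apply: (@integrableS _ _ _ mu `[0, T]) => //.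
    by apply: subset_itvW.
  apply: continuous_compact_integrable; first exact: segment_compact.
  apply: continuous_subspaceT => t; under eq_fun do rewrite expr2.
  by apply: cvgM; exact: phic.
have /integrableP[_] := integrableZl mD (`|e| ^+ 2) pp.
apply: le_lt_trans; rewrite le_eqVlt; apply/orP; left; apply/eqP.
apply: eq_integral => t _; rewrite -EFinM gee0_abs; last first.
  by rewrite lee_fin; apply: mulr_ge0; exact: sqr_ge0.
by rewrite normrZ exprMn real_normK ?num_real// mulrC.
Qed.

(** If e represents l in E, then the function phi e represents, in L^2(0,T;E), the
    functional which applies l pointwise and integrates against phi. *)
Lemma integral_test_dot {E : hilbertType R} (l : E -> R) (C : R) (phi : R -> R) :
  (forall a x y, l (a *: x + y) = a * l x + l y) ->
  (forall x, `|l x| <= C * `|x|) -> continuous phi ->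
  exists z : L2 T E, forall x : L2 T E,
    \int[mu]_(t in D) (l (L2repr x t) * phi t) = dot x z.
Proof.
move=> lin bnd phic.
have [e le] := riesz_representation E l C (hilbert_rapidly_complete E) lin bnd.
have sz := sq_integrable_scale phi e phic.
pose z : L2 T E := (\pi_(L2 T E)%qT (MkL2fun (mem_set sz))).
exists z => x; rewrite L2dotE /Rintegral; congr fine.
have zE : L2repr z = (fun t => phi t *: e) %[ae mu in D] by exact: L2repr_pi.
have sx := L2repr_sq_integrable x.
have -> : (fun t => (l (L2repr x t) * phi t)%:E) =
    (fun t => (dot (L2repr x t) (phi t *: e))%:E).
  by apply/funext => t; rewrite dotZr le mulrC.
apply: ae_eq_integral => //.
- exact: measurable_int (dot_integrable sx sz).
- exact: measurable_int (dot_integrable sx (L2repr_sq_integrable z)).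
- by apply: ae_imp zE => t zE Dt /=; rewrite (zE Dt).
Qed.

Context {U H Us : hilbertType R} (G : gelfand U H Us).

Lemma gpair_le w v : `|gpair G w v| <= `|v| * `|w|.
Proof.
rewrite mulrC; apply: (@opnorm_le _ _ _ (gpair G w)).
by rewrite gpair_norm.
Qed.

Lemma gemb_le : exists C, forall v, `|gemb G v| <= C * `|v|.
Proof.
have /linear_boundedP Lb :=
  continuous_linear_bounded 0 (@gemb_continuous _ _ _ _ G 0).
by near +oo_R => C; exists C; near: C.
Unshelve. all: by end_near. Qed.

(** Each instance of the equation defining the weak derivative is thus an equation
    between inner products with fixed vectors, and passes to norm limits. *)
Lemma weak_derivative_dot (v : U) (phi : R -> R) : test_function T phi ->
  exists z1 z2, forall (u : L2 T U) (w : L2 T Us),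
    \int[mu]_(t in D) (gpair G (L2repr w t) v * phi t) = dot w z1 /\
    \int[mu]_(t in D) (dot (gemb G (L2repr u t)) (gemb G v) * derive1 phi t) =
      dot u z2.
Proof.
move=> [dphi _].
have cphi n : continuous (derive1n n phi).
  move=> t; apply: differentiable_continuous.
  by apply/derivable1_diffP; exact: dphi.
have [z1 z1P] := @integral_test_dot Us (fun w => gpair G w v) `|v| phi
  (fun a x y => linearPl (gpair G) v a x y) (gpair_le^~ v) (cphi 0%N).
have [C gC] := gemb_le.
have [||z2 z2P] := @integral_test_dot U (fun u => dot (gemb G u) (gemb G v))
  (C * `|gemb G v|) (derive1 phi) _ _ (cphi 1%N).
- by move=> a x y; rewrite linearP dotDl dotZl.
- move=> x; rewrite (le_trans (cauchy_schwarz _ _))// mulrAC ler_wpM2r//.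
by exists z1, z2 => u w; split.
Qed.

Lemma sqr_norm_evolution (u : evolution T G) :
  `|u| ^+ 2 = `|state u| ^+ 2 + `|ddt u| ^+ 2.
Proof. by rewrite -dot_norm evolution_dotE !dot_norm. Qed.

Lemma state_le (u : evolution T G) : `|state u| <= `|u|.
Proof.
rewrite -(@ler_pXn2r _ 2) ?nnegrE//.
by rewrite sqr_norm_evolution lerDl exprn_ge0.
Qed.

Lemma ddt_le (u : evolution T G) : `|ddt u| <= `|u|.
Proof.
rewrite -(@ler_pXn2r _ 2) ?nnegrE//.
by rewrite sqr_norm_evolution lerDr exprn_ge0.
Qed.

Lemma stateB (u v : evolution T G) : state (u - v) = state u - state v.
Proof. by []. Qed.

Lemma ddtB (u v : evolution T G) : ddt (u - v) = ddt u - ddt v.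
Proof. by []. Qed.

Lemma evolution_rapidly_complete : rapidly_complete (evolution T G).
Proof.
move=> u uC.
have [a ua] : exists a : L2 T U, state (u n) @[n --> \oo] --> a.
  apply: L2_rapidly_complete => n; rewrite -stateB.
  exact: le_trans (state_le _) (uC n).
have [b ub] : exists b : L2 T Us, ddt (u n) @[n --> \oo] --> b.
  apply: L2_rapidly_complete => n; rewrite -ddtB.
  exact: le_trans (ddt_le _) (uC n).
have wab : weak_derivative G a b.
  move=> v phi tphi; have [z1 [z2 zP]] := weak_derivative_dot v phi tphi.
  have [-> ->] := zP a b; rewrite dotC (dotC a).
  have h1 : dot z1 (ddt (u n)) @[n --> \oo] --> (dot z1 b : R).
    exact: dot_cvgr.
  have h2 : dot z2 (state (u n)) @[n --> \oo] --> (dot z2 a : R).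
    exact: dot_cvgr.
  have h3 : dot z1 (ddt (u n)) @[n --> \oo] --> (- dot z2 a : R).
    have -> : (fun n => dot z1 (ddt (u n))) = (fun n => - dot z2 (state (u n))).
      apply/funext => n; have := set_mem (evolution_valP (u n)) v phi tphi.
      have [-> ->] := zP (state (u n)) (ddt (u n)).
      by rewrite dotC (dotC z2).
    exact: cvgN.
  exact: cvg_unique h1 h3.
pose x := @Evolution R T U H Us G (a, b) (mem_set wab).
exists x; apply/subr_cvg0/norm_cvg0P.
have sq0 (w : nat -> R) : w n @[n --> \oo] --> (0 : R) ->
    w n ^+ 2 @[n --> \oo] --> (0 : R).
  by move=> w0; rewrite -(mul0r 0); under eq_fun do rewrite expr2; exact: cvgM.
have h : `|state (u n) - a| ^+ 2 + `|ddt (u n) - b| ^+ 2 @[n --> \oo] -->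
    (0 : R).
  rewrite -[X in _ --> X]addr0.
  by apply: cvgD; apply: sq0; apply/norm_cvg0P/subr_cvg0.
have -> : (fun n => `|u n - x|) =
    (fun n => Num.sqrt (`|state (u n) - a| ^+ 2 + `|ddt (u n) - b| ^+ 2)).
  apply/funext => n.
  by rewrite -[a]/(state x) -[b]/(ddt x) -stateB -ddtB -sqr_norm_evolution
    sqrtr_sqr normr_id.
rewrite -(@sqrtr0 R).
exact: (@cvg_comp _ _ _ _ _ _ _ _ h (@sqrt_continuous R 0)).
Qed.

End evolution_complete.

(** * The parameter identification problem *)

Lemma closed_ball_norm {R : realType} {V : normedModType R} (c : V) (r : R) u :
  0 < r -> closed_ball c r u <-> `|u - c| <= r.
Proof. by move=> r0; rewrite closed_ballE// /closed_ball_/= distrC. Qed.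

Lemma bigO_of_bound {R : realType} (e w : nat -> R) (K : R) : 0 < K ->
  (forall k, 0 <= e k) -> (forall k, 0 <= w k) ->
  (forall k, (0 < k)%N -> e k <= K * w k) ->
  (e : nat -> R^o) =O_\oo (w : nat -> R^o).
Proof.
move=> K0 e0 w0 h; apply/eqO_exP; exists K => //; near=> k.
rewrite ger0_norm// [`|w k|]ger0_norm//; apply: h; near: k.
exact: nbhs_infty_gt.
Unshelve. all: by end_near. Qed.

Lemma powR_decay_cvg0 {R : realType} (K p : R) : 0 < p ->
  K * (1 / k%:R `^ p) @[k --> \oo] --> (0 : R).
Proof.
move=> p0; rewrite -(mulr0 K); apply: cvgM; first exact: cvg_cst.
apply/cvgrPdist_lt => e e0; near=> k.
have k0 : 0 < k%:R :> R by rewrite ltr0n; near: k; exact: nbhs_infty_gt.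
rewrite sub0r normrN div1r ger0_norm ?invr_ge0 ?powR_ge0//.
rewrite invf_plt ?posrE ?powR_gt0//.
have -> : e^-1 = (e^-1 `^ p^-1) `^ p.
  by rewrite -powRrM mulVf ?gt_eqF// powRr1// invr_ge0 ltW.
apply: gt0_ltr_powR; rewrite ?nnegrE ?powR_ge0 ?(ltW k0)//.
by near: k; exact: nbhs_infty_gtr.
Unshelve. all: by end_near. Qed.

Theorem theorem1 (R : realType) (T : R) (X U H Us : hilbertType R)
    (G : gelfand U H Us) (A : {linear X -> H}) (f : R -> X -> U -> Us)
    (thetad : X) (ud : evolution T G) (rho r : R) (ustar : X -> evolution T G) :
  let F : X -> evolution T G -> hprod (L2 T Us) H := state_operator A f in
  let phi : hprod (L2 T Us) H := (0, 0) in
  0 < T -> (opnorm A < +oo)%E ->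
  caratheodory T f -> induces_nemytskii T G f ->
  (forall theta u, differentiable (F theta) u) ->
  F thetad ud = phi ->
  0 < rho -> 0 < r ->
  (forall theta, closed_ball thetad rho theta ->
    closed_ball ud (r / 2) (ustar theta) /\ F theta (ustar theta) = phi) ->
  forall M mu : R, 0 < M -> M < Num.sqrt 2 -> 0 < mu ->
  (forall theta u, closed_ball thetad rho theta -> closed_ball ud r u ->
    (opnorm ('d (F theta) u) <= M%:E)%E) ->
  (forall theta u v, closed_ball thetad rho theta ->
    closed_ball ud r u -> closed_ball ud r v ->
    2 * dot (F theta u - F theta v) ('d (F theta) u (u - v)) >=
      (M ^+ 2 + mu) * `|F theta u - F theta v| ^+ 2) ->
  (forall (theta : X) (u : nat -> evolution T G),
    closed_ball thetad rho theta ->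
    closed_ball (ustar theta) (r / 2) (u 0%N) -> landweber (F theta) phi u ->
    (forall k, closed_ball ud r (u k)) /\
    (exists2 ubar, F theta ubar = phi & weakly_cvg u ubar)) /\
  (forall C alpha : R, 0 < C -> 1 <= alpha ->
    (forall theta u, closed_ball thetad rho theta -> closed_ball ud r u ->
      C * `|F theta u - F theta (ustar theta)| >=
        `|u - ustar theta| `^ alpha) ->
    forall (theta : X) (u : nat -> evolution T G),
      closed_ball thetad rho theta ->
      closed_ball (ustar theta) (r / 2) (u 0%N) -> landweber (F theta) phi u ->
      [/\ u k @[k --> \oo] --> ustar theta,
          (fun k => `|u k - ustar theta| : R^o) =O_\oo
            (fun k => 1 / k%:R `^ (1 / (2 * alpha)) : R^o)
        & (fun k => `|F theta (u k) - phi| : R^o) =O_\oo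
            (fun k => 1 / k%:R `^ (1 / (2 * alpha)) : R^o)]).
Proof.
move=> F phi T0 _ _ _ _ _ _ r0 sol M mu M0 _ mu0 FM cone.
have cV := @evolution_rapidly_complete R T U H Us G.
have ballP v : closed_ball ud r v <-> `|v - ud| <= r by exact: closed_ball_norm.
have r2 : 0 < r / 2 by rewrite divr_gt0.
pose dF theta u : {linear evolution T G -> hprod (L2 T Us) H} := 'd (F theta) u.
have dFM theta : closed_ball thetad rho theta -> forall u, `|u - ud| <= r ->
    forall v, `|dF theta u v| <= M * `|v|.
  by move=> ? u /ballP ur; apply: opnorm_le; exact: FM.
have dFcone theta : closed_ball thetad rho theta -> forall u v,
    `|u - ud| <= r -> `|v - ud| <= r ->
    (M ^+ 2 + mu) * `|F theta u - F theta v| ^+ 2 <=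
    2 * dot (F theta u - F theta v) (dF theta u (u - v)).
  by move=> ? u v /ballP ur /ballP vr; exact: cone.
have lip theta u : closed_ball thetad rho theta -> `|u - ud| <= r ->
    `|F theta u - phi| <= 2 * M / (M ^+ 2 + mu) * `|u - ustar theta|.
  move=> th ur; have [/(closed_ball_norm _ _ _ r2) sr <-] := sol theta th.
  apply: (@lipschitz_of_cone _ _ _ (F theta) (dF theta) ud r M mu) => //.
  - exact: dFM.
  - exact: dFcone.
  - by rewrite (le_trans sr)// ler_pdivrMr// ler_pMr// ler1n.
have iter theta (u : nat -> evolution T G) : closed_ball thetad rho theta ->
    closed_ball (ustar theta) (r / 2) (u 0%N) -> landweber (F theta) phi u ->
    (forall k, `|u k - ud| <= r) /\
    (exists2 ubar, F theta ubar = phi & weakly_cvg u ubar).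
  move=> th /(closed_ball_norm _ _ _ r2) u0 lw.
  have [/(closed_ball_norm _ _ _ r2) sr Fs] := sol theta th.
  split=> [k|].
    by case: (@landweber_stays _ _ _ cV (F theta) (dF theta) phi ud r M mu
      (ltW r0) M0 mu0 (dFM theta th) (dFcone theta th) _ u sr Fs u0 lw k).
  exact: (@landweber_weak_cvg _ _ _ cV (F theta) (dF theta) phi ud r M mu
    (ltW r0) M0 mu0 (dFM theta th) (dFcone theta th) _ u sr Fs u0 lw).
split=> [theta u th u0 lw|C alpha C0 alpha1 coer theta u th u0 lw].
  by have [ur uw] := iter theta u th u0 lw; split=> // k; exact/ballP.
have [stays _] := iter theta u th u0 lw.
move: u0 => /(closed_ball_norm _ _ _ r2) u0.
have [/(closed_ball_norm _ _ _ r2) sr Fs] := sol theta th.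
have coer' v : `|v - ud| <= r ->
    `|v - ustar theta| `^ alpha <= C * `|F theta v - F theta (ustar theta)|.
  by move=> /ballP vr; exact: coer.
have [K K0 rate] := @landweber_rate _ _ _ cV (F theta) (dF theta) phi ud r M mu
  (ltW r0) M0 mu0 (dFM theta th) (dFcone theta th) _ u sr Fs u0 lw C alpha C0
  alpha1 coer'.
have p0 : 0 < 1 / (2 * alpha).
  by rewrite divr_gt0// mulr_gt0// (lt_le_trans ltr01).
have w0 k : 0 <= 1 / k%:R `^ (1 / (2 * alpha)) :> R.
  by rewrite divr_ge0// powR_ge0.
have L0 : 0 < 2 * M / (M ^+ 2 + mu).
  by rewrite divr_gt0// ?mulr_gt0// addr_gt0// exprn_gt0.
split.
- apply/subr_cvg0/norm_cvg0P.
  apply: (squeeze_cvgr _ (cvg_cst 0) (powR_decay_cvg0 K _ p0)); near=> k.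
  rewrite normr_ge0/=; apply: rate; near: k; exact: nbhs_infty_gt.
- exact: (bigO_of_bound _ _ K).
- apply: (bigO_of_bound _ _ (2 * M / (M ^+ 2 + mu) * K)) => //.
    exact: mulr_gt0.
  move=> k k0; rewrite -mulrA (le_trans (lip theta _ th (stays k)))//.
  by rewrite ler_pM2l//; exact: rate.
Unshelve. all: by end_near. Qed.
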